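(* Let $H_1$ and $H_2$ be graphs, neither of which is isomorphic to $\overline{P_1+P_3}$ or $P_1+P_3$, with $\{H_1,H_2\}\ne\{3P_1,\overline{S_{1,2,3}}\}$, and let $\mathcal{G}$ be the class of $(H_1,H_2)$-free graphs. Then $\mathcal{G}$ satisfies none of the four conditions (A), (B), (C), (D) below if and only if the unordered pair $\{H_1,H_2\}$ is one of the 18 pairs listed in (E). (A) $\mathcal{G}$ is equivalent to a class of $(F_1,F_2)$-free graphs such that one of the following holds: - $F_1\subseteq_i P_4$ or $F_2\subseteq_i P_4$; - $F_1=K_s$ and $F_2=tP_1$ for some $s,t\ge1$; - $F_1\subseteq_i\mathrm{paw}$ and $F_2\subseteq_i K_{1,3}+3P_1$, $K_{1,3}+P_2$, $P_1+P_2+P_3$, $P_1+P_5$, $P_1+S_{1,1,2}$, $P_2+P_4$, $P_6$, $S_{1,1,3}$ or $S_{1,2,2}$; - $F_1\subseteq_i\mathrm{diamond}$ and $F_2\subseteq_i P_1+2P_2$, $3P_1+P_2$ or $P_2+P_3$; - $F_1\subseteq_i\mathrm{gem}$ and $F_2\subseteq_i P_1+P_4$ or $P_5$; - $F_1\subseteq_i K_3+P_1$ and $F_2\subseteq_i K_{1,3}$; - $F_1\subseteq_i\overline{2P_1+P_3}$ and $F_2\subseteq_i 2P_1+P_3$. (B) $\mathcal{G}$ is a subclass of the class of $(P_6,\overline{2P_2})$-free graphs or of the class of $(2P_2,\overline{P_2+P_3})$-free graphs. (C) $\mathcal{G}$ is equivalent to a class of $(F_1,F_2)$-free graphs such that one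 of the following holds: - $F_1\notin\mathcal{S}$ and $F_2\notin\mathcal{S}$; - $F_1\notin\overline{\mathcal{S}}$ and $F_2\notin\overline{\mathcal{S}}$; - $F_1\supseteq_i K_3+P_1$ and $F_2\supseteq_i 4P_1$ or $2P_2$; - $F_1\supseteq_i\mathrm{diamond}$ and $F_2\supseteq_i K_{1,3}$, $5P_1$ or $P_2+P_4$; - $F_1\supseteq_i K_3$ and $F_2\supseteq_i 2P_1+2P_2$, $2P_1+P_4$, $4P_1+P_2$, $3P_2$ or $2P_3$; - $F_1\supseteq_i K_4$ and $F_2\supseteq_i P_1+P_4$, $3P_1+P_2$ or $2P_2$; - $F_1\supseteq_i\mathrm{gem}$ and $F_2\supseteq_i P_1+2P_2$. (D) $\mathcal{G}$ contains the class of $(F_1,F_2)$-free graphs for some $F_1,F_2$ such that one of the following holds: - $F_1\supseteq_i\mathrm{diamond}$ and $F_2\supseteq_i P_1+P_6$; - $F_1\supseteq_i 2P_1+P_2$ and $F_2\supseteq_i\overline{P_6}$; - $F_1\supseteq_i\mathrm{gem}$ and $F_2\supseteq_i P_6$; - $F_1\supseteq_i P_1+2P_2$ or $P_6$, and $F_2\supseteq_i\overline{P_1+2P_2}$ or $\overline{P_2+P_3}$; - $F_1\supseteq_i 2P_2$ and $F_2\supseteq_i\overline{P_2+P_4}$, $\overline{3P_2}$ or $\overline{P_5}$. (E) The pairs $\{A,B\}$ with: - $A=\mathrm{diamond}$ and $B=P_6$; - $A=C_4$ and $B\in\{P_1+2P_2,\ P_2+P_4,\ 3P_2\}$; - $A=\overline{P_1+2P_2}$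 and $B\in\{2P_2,\ P_2+P_3,\ P_5\}$; - $A=\overline{P_2+P_3}$ and $B\in\{P_2+P_3,\ P_5\}$; - $A=K_3$ and $B\in\{P_1+S_{1,1,3},\ S_{1,2,3}\}$; - $A=3P_1$ and $B=\overline{P_1+S_{1,1,3}}$; - $A=\mathrm{diamond}$ and $B\in\{P_1+P_2+P_3,\ P_1+P_5\}$; - $A=2P_1+P_2$ and $B\in\{\overline{P_1+P_2+P_3},\ \overline{P_1+P_5}\}$; - $A=\mathrm{gem}$ and $B=P_2+P_3$; - $A=P_1+P_4$ and $B=\overline{P_2+P_3}$. (In a list such as ''$F\subseteq_i X$, $Y$ or $Z$'' the relation is meant to hold for at least one of the listed graphs, and similarly for $\supseteq_i$.)
   Context: Graphs are finite, simple and undirected, and considered up to isomorphism. $F\subseteq_i G$ (equivalently $G\supseteq_i F$) means that $F$ is (isomorphic to) an induced subgraph of $G$. A graph is $(H_1,H_2)$-free if it contains neither $H_1$ nor $H_2$ as an induced subgraph. $C_t,K_t,P_t$ are the cycle, complete graph and path on $t$ vertices; $K_{s,t}$ is the complete bipartite graph; $G_1+G_2$ is the disjoint union; $rG$ is the disjoint union of $r$ copies of $G$; $\overline{G}$ is the complement. The paw is $\overline{P_1+P_3}$, the diamond is $\overline{2P_1+P_2}$, the gem is $\overline{P_1+P_4}$. For $1\le h\le i\le j$, the subdivided claw $S_{h,i,j}$ is the tree with one vertex $x$ of degree $3$ and exactly three leaves, at distances $h,i,j$ from $x$. $\mathcal{S}$ is the class of graphs every connected component of which is a subdivided claw or a path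 on at least one vertex; $\overline{\mathcal{S}}$ is the class of complements of graphs in $\mathcal{S}$. The classes of $(H_1,H_2)$-free graphs and $(H_3,H_4)$-free graphs are equivalent if the unordered pair $H_3,H_4$ can be obtained from the unordered pair $H_1,H_2$ by some combination of the operations: (1) complementing both graphs in the pair; (2) if one of the graphs in the pair is $3P_1$, replacing it with $P_1+P_3$, or vice versa. Conditions (A) and (B) are the sufficient conditions known for the class of atoms (graphs with no clique cut-set) in $\mathcal{G}$ to have bounded clique-width, and (C) and (D) are the sufficient conditions known for it to have unbounded clique-width; the theorem says that the pairs left undecided by these conditions are exactly those in (E). *)

(* Defs.v *)
From mathcomp Require Import all_boot.
From Stdlib Require List.

Set Implicit Arguments.
Unset Strict Implicit.
Unset Printing Implicit Defensive.

Declare Scope sgraph_scope.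
Delimit Scope sgraph_scope with sg.

Record sgraph : Type := SGraph {
  vertex :> finType;
  adj : rel vertex;
  adj_sym : symmetric adj;
  adj_irr : irreflexive adj }.

Bind Scope sgraph_scope with sgraph.

Section OfRel.
Variables (T : finType) (e : rel T).
Let a : rel T := [rel x y | (x != y) && (e x y || e y x)].
Fact of_rel_sym : symmetric a.
Proof. by move=> x y; rewrite /a /= eq_sym orbC. Qed.
Fact of_rel_irr : irreflexive a.
Proof. by move=> x; rewrite /a /= eqxx. Qed.
(* Each edge only has to be listed in one direction by [e]; loops are
   dropped. *)
Definition of_rel : sgraph := SGraph of_rel_sym of_rel_irr.
End OfRel.

Definition iso (F G : sgraph) : Prop :=
  exists2 f : F -> G, bijective f & forall x y, adj (f x) (f y) = adj x y.

Section Induced.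
Variables (G : sgraph) (A : {set G}).
Let a : rel {x : G | x \in A} := [rel x y | adj (val x) (val y)].
Fact induced_sym : symmetric a.
Proof. by move=> x y; rewrite /a /= adj_sym. Qed.
Fact induced_irr : irreflexive a.
Proof. by move=> x; rewrite /a /= adj_irr. Qed.
Definition induced : sgraph := SGraph induced_sym induced_irr.
End Induced.

Definition isub (F G : sgraph) : Prop := exists A : {set G}, iso F (induced A).

Section Complement.
Variable G : sgraph.
Let a : rel G := [rel x y | (x != y) && ~~ adj x y].
Fact co_sym : symmetric a.
Proof. by move=> x y; rewrite /a /= eq_sym adj_sym. Qed.
Fact co_irr : irreflexive a.
Proof. by move=> x; rewrite /a /= eqxx. Qed.
Definition co : sgraph := SGraph co_sym co_irr.
End Complement.

Section DisjointUnion.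
Variables F G : sgraph.
Let a : rel (F + G)%type := fun u v =>
  match u, v with
  | inl x, inl y => adj x y
  | inr x, inr y => adj x y
  | _, _ => false
  end.
Fact union_sym : symmetric a.
Proof. by case=> x [] y //=; rewrite adj_sym. Qed.
Fact union_irr : irreflexive a.
Proof. by case=> x /=; rewrite adj_irr. Qed.
Definition union : sgraph := SGraph union_sym union_irr.
End DisjointUnion.

Section Copies.
Variables (r : nat) (G : sgraph).
Let a : rel ('I_r * G)%type :=
  [rel u v | (u.1 == v.1) && adj u.2 v.2].
Fact copies_sym : symmetric a.
Proof. by move=> x y; rewrite /a /= eq_sym adj_sym. Qed.
Fact copies_irr : irreflexive a.
Proof. by move=> x; rewrite /a /= adj_irr andbF. Qed.
Definition copies : sgraph := SGraph copies_sym copies_irr.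
End Copies.

Notation "F + G" := (union F G) : sgraph_scope.
Notation "r * G" := (copies r%N G) : sgraph_scope.

Definition Pn (t : nat) : sgraph := of_rel (fun i j : 'I_t => i.+1 == j :> nat).
(* A cycle only for [3 <= t]. *)
Definition Cn (t : nat) : sgraph :=
  of_rel (fun i j : 'I_t => i.+1 %% t == j :> nat).
Definition Kn (t : nat) : sgraph := of_rel (fun _ _ : 'I_t => true).
Definition Knm (s t : nat) : sgraph :=
  of_rel (fun u v : ('I_s + 'I_t)%type =>
    match u, v with inl _, inr _ => true | _, _ => false end).

(* [None] is the centre, joined to the first vertex of each of three disjoint
   paths on h, i and j vertices; the last vertices of these paths are then the
   leaves, at distances h, i and j from the centre (for h, i, j positive). *)
Definition Sclaw (h i j : nat) : sgraph :=
  of_rel (fun u v : option (Pn h + Pn i + Pn j)%sg =>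
    match u, v with
    | None, Some (inl (inl k)) => (k : 'I_h) == 0 :> nat
    | None, Some (inl (inr k)) => (k : 'I_i) == 0 :> nat
    | None, Some (inr k) => (k : 'I_j) == 0 :> nat
    | Some x, Some y => adj x y
    | _, _ => false
    end).

Local Open Scope sgraph_scope.

Definition paw : sgraph := co (Pn 1 + Pn 3).
Definition diamond : sgraph := co (2 * Pn 1 + Pn 2).
Definition gem : sgraph := co (Pn 1 + Pn 4).

Definition component (G : sgraph) (x : G) : sgraph :=
  induced [set y | connect (@adj G) x y].

Definition in_S (G : sgraph) : Prop :=
  forall x : G,
    (exists2 t, (1 <= t)%N & iso (component x) (Pn t)) \/
    (exists h i j, (1 <= h <= i)%N /\ (i <= j)%N /\
       iso (component x) (Sclaw h i j)).

Definition in_coS (G : sgraph) : Prop := exists2 H, in_S H & iso G (co H).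

(* Classes of graphs are predicates on [sgraph], all of them invariant under
   isomorphism. *)
Definition free (H1 H2 : sgraph) (G : sgraph) : Prop :=
  ~ isub H1 G /\ ~ isub H2 G.

Definition subclass (X Y : sgraph -> Prop) : Prop := forall G, X G -> Y G.

(* Equality of unordered pairs of graphs up to isomorphism. *)
Definition same_pair (H1 H2 F1 F2 : sgraph) : Prop :=
  (iso H1 F1 /\ iso H2 F2) \/ (iso H1 F2 /\ iso H2 F1).

(* [equiv_pair H1 H2 F1 F2]: the unordered pair F1, F2 can be obtained from the
   unordered pair H1, H2, so that the classes of (H1,H2)-free and of
   (F1,F2)-free graphs are equivalent. *)
Inductive equiv_pair (H1 H2 : sgraph) : sgraph -> sgraph -> Prop :=
| equiv_same F1 F2 :
    same_pair F1 F2 H1 H2 -> equiv_pair H1 H2 F1 F2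
| equiv_co F1 F2 F3 F4 :
    equiv_pair H1 H2 F1 F2 -> same_pair F3 F4 (co F1) (co F2) ->
    equiv_pair H1 H2 F3 F4
| equiv_3P1_P1P3 F1 F2 F3 F4 F :
    equiv_pair H1 H2 F1 F2 -> same_pair F1 F2 (3 * Pn 1) F ->
    same_pair F3 F4 (Pn 1 + Pn 3) F -> equiv_pair H1 H2 F3 F4
| equiv_P1P3_3P1 F1 F2 F3 F4 F :
    equiv_pair H1 H2 F1 F2 -> same_pair F1 F2 (Pn 1 + Pn 3) F ->
    same_pair F3 F4 (3 * Pn 1) F -> equiv_pair H1 H2 F3 F4.

Definition sub_some (F : sgraph) (s : seq sgraph) : Prop :=
  List.Exists (fun X => isub F X) s.
Definition sup_some (F : sgraph) (s : seq sgraph) : Prop :=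
  List.Exists (fun X => isub X F) s.

Definition casesA (F1 F2 : sgraph) : Prop :=
  (isub F1 (Pn 4) \/ isub F2 (Pn 4)) \/
  (exists s t, (1 <= s)%N /\ (1 <= t)%N /\
     iso F1 (Kn s) /\ iso F2 (t * Pn 1)) \/
  (isub F1 paw /\
     sub_some F2 [:: Knm 1 3 + 3 * Pn 1; Knm 1 3 + Pn 2; Pn 1 + Pn 2 + Pn 3;
                     Pn 1 + Pn 5; Pn 1 + Sclaw 1 1 2; Pn 2 + Pn 4; Pn 6;
                     Sclaw 1 1 3; Sclaw 1 2 2]) \/
  (isub F1 diamond /\
     sub_some F2 [:: Pn 1 + 2 * Pn 2; 3 * Pn 1 + Pn 2; Pn 2 + Pn 3]) \/
  (isub F1 gem /\ sub_some F2 [:: Pn 1 + Pn 4; Pn 5]) \/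
  (isub F1 (Kn 3 + Pn 1) /\ isub F2 (Knm 1 3)) \/
  (isub F1 (co (2 * Pn 1 + Pn 3)) /\ isub F2 (2 * Pn 1 + Pn 3)).

Definition condA (H1 H2 : sgraph) : Prop :=
  exists F1 F2, equiv_pair H1 H2 F1 F2 /\ casesA F1 F2.

Definition condB (H1 H2 : sgraph) : Prop :=
  subclass (free H1 H2) (free (Pn 6) (co (2 * Pn 2))) \/
  subclass (free H1 H2) (free (2 * Pn 2) (co (Pn 2 + Pn 3))).

Definition casesC (F1 F2 : sgraph) : Prop :=
  (~ in_S F1 /\ ~ in_S F2) \/
  (~ in_coS F1 /\ ~ in_coS F2) \/
  (isub (Kn 3 + Pn 1) F1 /\ sup_some F2 [:: 4 * Pn 1; 2 * Pn 2]) \/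
  (isub diamond F1 /\ sup_some F2 [:: Knm 1 3; 5 * Pn 1; Pn 2 + Pn 4]) \/
  (isub (Kn 3) F1 /\
     sup_some F2 [:: 2 * Pn 1 + 2 * Pn 2; 2 * Pn 1 + Pn 4; 4 * Pn 1 + Pn 2;
                     3 * Pn 2; 2 * Pn 3]) \/
  (isub (Kn 4) F1 /\ sup_some F2 [:: Pn 1 + Pn 4; 3 * Pn 1 + Pn 2; 2 * Pn 2]) \/
  (isub gem F1 /\ isub (Pn 1 + 2 * Pn 2) F2).

Definition condC (H1 H2 : sgraph) : Prop :=
  exists F1 F2, equiv_pair H1 H2 F1 F2 /\ casesC F1 F2.

Definition casesD (F1 F2 : sgraph) : Prop :=
  (isub diamond F1 /\ isub (Pn 1 + Pn 6) F2) \/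
  (isub (2 * Pn 1 + Pn 2) F1 /\ isub (co (Pn 6)) F2) \/
  (isub gem F1 /\ isub (Pn 6) F2) \/
  (sup_some F1 [:: Pn 1 + 2 * Pn 2; Pn 6] /\
     sup_some F2 [:: co (Pn 1 + 2 * Pn 2); co (Pn 2 + Pn 3)]) \/
  (isub (2 * Pn 2) F1 /\
     sup_some F2 [:: co (Pn 2 + Pn 4); co (3 * Pn 2); co (Pn 5)]).

Definition condD (H1 H2 : sgraph) : Prop :=
  exists F1 F2, subclass (free F1 F2) (free H1 H2) /\ casesD F1 F2.

Definition pairsE : seq (sgraph * sgraph) :=
  [:: (diamond, Pn 6);
      (Cn 4, Pn 1 + 2 * Pn 2); (Cn 4, Pn 2 + Pn 4); (Cn 4, 3 * Pn 2);
      (co (Pn 1 + 2 * Pn 2), 2 * Pn 2); (co (Pn 1 + 2 * Pn 2), Pn 2 + Pn 3);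
      (co (Pn 1 + 2 * Pn 2), Pn 5);
      (co (Pn 2 + Pn 3), Pn 2 + Pn 3); (co (Pn 2 + Pn 3), Pn 5);
      (Kn 3, Pn 1 + Sclaw 1 1 3); (Kn 3, Sclaw 1 2 3);
      (3 * Pn 1, co (Pn 1 + Sclaw 1 1 3));
      (diamond, Pn 1 + Pn 2 + Pn 3); (diamond, Pn 1 + Pn 5);
      (2 * Pn 1 + Pn 2, co (Pn 1 + Pn 2 + Pn 3));
      (2 * Pn 1 + Pn 2, co (Pn 1 + Pn 5));
      (gem, Pn 2 + Pn 3);
      (Pn 1 + Pn 4, co (Pn 2 + Pn 3))]%sg.

Definition condE (H1 H2 : sgraph) : Prop :=
  List.Exists (fun p => same_pair H1 H2 p.1 p.2) pairsE.

(* Main.v *)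
Require Import Defs.
From mathcomp Require Import all_boot.

(* If (C) fails, then the pair consists of a graph in the complement of S and a
   graph in S, unless one graph lies in both classes, hence is in P_4 and (A)
   holds. Write the pair as {co G1, G2} with G1 and G2 in S; complementation then
   exchanges G1 and G2.
   A graph in S that is not an induced subgraph of P_4 contains 3P_1 or 2P_2. So
   if G1 forms with each of these two graphs a pair that satisfies (C), then
   {co G1, G2} satisfies (A) or (C); and so does any larger graph in place of G1.
   The remaining graphs in S are the edgeless ones and finitely many others, on
   at most 7 vertices. They are found by adding a vertex of degree at most 1
   repeatedly, and all pairs of them are inspected by computation.
   Conversely, the pairs equivalent to the ones listed in (E) form a finite set,
   on which the four conditions are refuted by computation. *)

Set Implicit Arguments.
Unset Strict Implicit.
Unset Printing Implicit Defensive.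

(** * Induced subgraphs by computation *)

Notation code := (seq (seq bool)).

(** The strict upper triangle of the adjacency matrix, row by row: graphs on listed vertices become
    plain data, in which embeddings can be searched by evaluation. *)
Fixpoint code_of (T : Type) (e : rel T) (s : seq T) : code :=
  if s is x :: s' then [seq e x y | y <- s'] :: code_of e s' else [::].

Fixpoint code_adj (c : code) (i j : nat) : bool :=
  if c is r :: c' then
    match i, j with
    | 0, 0 => false
    | 0, k.+1 | k.+1, 0 => nth false r k
    | i'.+1, j'.+1 => code_adj c' i' j'
    end
  else false.

(* [vm_compute] evaluates both arguments of [&&] and [||], hence the explicit
   conditionals here and below. *)
Notation "b &&& c" := (if b then c else false) (at level 40, left associativity).
Notation "b ||| c" := (if b then true else c) (at level 50, left associativity).

Definition lazy_has (T : Type) (a : pred T) : pred (seq T) :=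
  fix loop s := if s is x :: s' then a x ||| loop s' else false.

Definition fits (T : eqType) (e : rel T) (v : T) :
    seq bool -> seq T -> bool :=
  fix loop r acc :=
    match r, acc with
    | [::], [::] => true
    | b :: r', w :: acc' => (v != w) &&& (e v w == b) &&& loop r' acc'
    | _, _ => false
    end.

(** Backtracking. A row refers to later vertices only, so the rows are consumed from the last one
    on: [acc] holds the vertices placed so far, and [fits] compares the current row with all of
    them. *)
Fixpoint search (T : eqType) (e : rel T) (u : seq T) (rs : code) (acc : seq T) :
    bool :=
  if rs is r :: rs' then
    lazy_has (fun v => fits e v r acc &&& search e u rs' (v :: acc)) u
  else true.

Definition emb (c d : code) : bool :=
  (size c <= size d) &&& search (code_adj d) (iota 0 (size d)) (rev c) [::].

Definition eqv (c d : code) : bool := (size c == size d) &&& emb c d.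

(** Negating every entry is right because the diagonal is not recorded. *)
Definition coc (c : code) : code := map (map negb) c.

Lemma size_code_of T (e : rel T) s : size (code_of e s) = size s.
Proof. by elim: s => //= x s ->. Qed.

Lemma code_of_map T U (e : rel T) (f : U -> T) s :
  code_of e (map f s) = code_of (relpre f e) s.
Proof. by elim: s => //= x s ->; rewrite -map_comp. Qed.

Lemma eq_in_code_of (T : eqType) (e e' : rel T) s :
  {in s &, forall x y, e x y = e' x y} -> code_of e s = code_of e' s.
Proof.
elim: s => //= x s IH ee'; rewrite IH; last first.
  by move=> y z ys zs; apply: ee'; rewrite inE (ys, zs) orbT.
congr (_ :: _); apply/eq_in_map=> y ys.
by apply: ee'; rewrite inE ?eqxx // ys orbT.
Qed.

Lemma drop_code_of T (e : rel T) s1 s2 :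
  drop (size s1) (code_of e (s1 ++ s2)) = code_of e s2.
Proof. by elim: s1 => [|x s1 IH] //=; rewrite drop0. Qed.

Lemma code_adjE (T : Type) (e : rel T) x0 s i j :
  symmetric e -> irreflexive e -> i < size s -> j < size s ->
  code_adj (code_of e s) i j = e (nth x0 s i) (nth x0 s j).
Proof.
move=> e_sym e_irr; elim: s i j => [|x s IH] [|i] [|j] //= si sj.
- by rewrite (nth_map x0).
- by rewrite (nth_map x0) // e_sym.
by rewrite IH.
Qed.

Lemma lazy_hasE (T : Type) (a : pred T) s : lazy_has a s = has a s.
Proof. by []. Qed.

Lemma fitsE (T : eqType) (e : rel T) v r acc :
  fits e v r acc = (v \notin acc) && ([seq e v w | w <- acc] == r).
Proof.
elim: r acc => [|b r IH] [|w acc] //=; first by rewrite andbF.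
rewrite inE negb_or IH eqseq_cons.
by case: (v != w); case: (e v w == b); rewrite //= andbF.
Qed.

Lemma searchP (T : eqType) (e : rel T) u rs acc :
  uniq acc -> {subset acc <= u} ->
  reflect (exists t, [/\ uniq (t ++ acc), {subset t ++ acc <= u} &
                         code_of e (t ++ acc) = rev rs ++ code_of e acc])
          (search e u rs acc).
Proof.
elim: rs acc => [|r rs IH] acc Uacc sub /=.
  by left; exists [::].
rewrite lazy_hasE; apply: (iffP hasP) => [[v vu]|[t [Ut tu Ct]]].
  rewrite fitsE; case: ifP => // /andP[vacc /eqP Er] /IH [].
  - by rewrite /= vacc.
  - by move=> w; rewrite inE => /predU1P[->|/sub].
  move=> t [Ut tu Ct]; exists (rcons t v); rewrite cat_rcons; split=> //.
  by rewrite Ct /= Er rev_cons cat_rcons.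
have /eqP : size (code_of e (t ++ acc)) = (size rs).+1 + size acc.
  by rewrite Ct size_cat size_rev size_code_of.
rewrite size_code_of size_cat eqn_add2r => /eqP.
(* The vertex next to [acc] is the one chosen for the row [r]. *)
case/lastP: t Ut tu Ct => // t v; rewrite cat_rcons size_rcons => Ut tu Ct [st].
have vu : v \in u by apply: tu; rewrite mem_cat mem_head orbT.
have [|] := boolP (uniq (v :: acc)); last first.
  by move: Ut; rewrite cat_uniq => /and3P[_ _ ->].
move=> Uva; exists v; rewrite // fitsE; have /andP[-> _] := Uva.
have := drop_code_of e t (v :: acc).
rewrite Ct rev_cons cat_rcons drop_size_cat ?size_rev //= => - [Er].
rewrite -Er eqxx; apply/IH.
- exact: Uva.
- by move=> w wa; apply: tu; rewrite mem_cat wa orbT.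
by exists t; split; rewrite ?Ct //= rev_cons cat_rcons Er.
Qed.

(** The search runs on positions in [s]; [nth] and [index] translate between positions and vertices.
    The empty list, which supplies no default for [nth], is treated apart. *)
Lemma embP (T : eqType) (e : rel T) s c :
  symmetric e -> irreflexive e -> uniq s ->
  reflect (exists t, [/\ uniq t, {subset t <= s} & code_of e t = c])
          (emb c (code_of e s)).
Proof.
move=> e_sym e_irr Us; case Es: s Us => [|x0 s0] Us.
  apply: (iffP idP) => [|[[|x t] [_ ts <-]] //].
    by case: c => // _; exists [::].
  by have := ts x (mem_head _ _).
rewrite -{s0}Es in Us *.
have nthE t : {subset t <= iota 0 (size s)} ->
    code_of (code_adj (code_of e s)) t = code_of e (map (nth x0 s) t).
  move=> ts; rewrite code_of_map; apply: eq_in_code_of => i j /ts + /ts.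
  by rewrite !mem_iota => /= si sj; rewrite (code_adjE x0).
rewrite /emb size_code_of.
apply: (iffP idP) => [|[t [Ut ts <-]]].
  case: ifP => // _ /searchP[] // t []; rewrite cats0 cats0 revK => Ut ts <-.
  exists (map (nth x0 s) t); rewrite nthE //; split=> //.
    rewrite map_inj_in_uniq // => i j /ts + /ts; rewrite !mem_iota => /= si sj.
    by move/eqP; rewrite nth_uniq // => /eqP.
  by move=> _ /mapP[i /ts + ->]; rewrite mem_iota => si; apply: mem_nth.
rewrite size_code_of uniq_leq_size //; apply/searchP => //.
exists (map (index^~ s) t); rewrite !cats0 revK.
have sub : {subset [seq index i s | i <- t] <= iota 0 (size s)}.
  by move=> _ /mapP[x /ts xs ->]; rewrite mem_iota index_mem.
split=> //.
  rewrite map_inj_in_uniq // => x y /ts xs /ts ys E.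
  by rewrite -(nth_index x0 xs) E nth_index.
rewrite nthE // -map_comp map_id_in // => x /ts xs /=.
by rewrite nth_index.
Qed.

(** * Codes of a graph and of its induced subgraphs *)

Definition contains (G : sgraph) (c : code) : Prop :=
  exists2 t : seq G, uniq t & code_of (@adj G) t = c.

Definition has_code (G : sgraph) (c : code) : Prop :=
  exists s : seq G, [/\ uniq s, forall x, x \in s & code_of (@adj G) s = c].

Lemma has_code_enum G : has_code G (code_of (@adj G) (enum G)).
Proof. by exists (enum G); split=> [||//]; rewrite ?enum_uniq // => x; rewrite mem_enum. Qed.

Lemma has_code_card G c : has_code G c -> #|G| = size c.
Proof.
case=> s [Us all_s <-]; rewrite size_code_of -(card_uniqP Us).
by apply: eq_card => x; rewrite all_s.
Qed.

Lemma has_code_containsP G c d : has_code G d -> reflect (contains G c) (emb c d).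
Proof.
move=> Gd; apply: (iffP idP); case: Gd => s [Us all_s <-].
  by case/(embP c (@adj_sym G) (@adj_irr G) Us)=> t [Ut _ Ct]; exists t.
by case=> t Ut Ct; apply/(embP c (@adj_sym G) (@adj_irr G) Us); exists t; split.
Qed.

Lemma emb_contains (G : sgraph) c (s : seq G) :
  uniq s -> emb c (code_of (@adj G) s) -> contains G c.
Proof.
by move=> Us /(embP c (@adj_sym G) (@adj_irr G) Us)[t [Ut _ Ct]]; exists t.
Qed.

Lemma isubE F G :
  isub F G <->
  exists2 g : F -> G, injective g & forall x y, adj (g x) (g y) = adj x y.
Proof.
split=> [[A [f [f' fK f'K] adj_f]]|[g g_inj adj_g]].
  exists (val \o f) => [|x y]; last by rewrite -adj_f.
  exact: inj_comp val_inj (can_inj fK).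
have gA x : g x \in [set g z | z in F] by apply: imset_f.
exists [set g z | z in F], (fun x => exist _ (g x) (gA x)) => //.
apply: inj_card_bij => [x y [/g_inj //]|].
by rewrite card_sig card_imset.
Qed.

Lemma isub_trans F G H : isub F G -> isub G H -> isub F H.
Proof.
move=> /isubE[f f_inj adj_f] /isubE[g g_inj adj_g]; apply/isubE.
by exists (g \o f) => [|x y]; [apply: inj_comp | rewrite /= adj_g].
Qed.

(** Equal codes mean that sending the i-th vertex of [s] to the i-th vertex of [t] preserves both
    adjacency and non-adjacency. *)
Lemma code_fun (F G : sgraph) (s : seq F) (t : seq G) :
  uniq s -> (forall x, x \in s) -> uniq t ->
  code_of (@adj G) t = code_of (@adj F) s ->
  exists2 g : F -> G, injective g & forall x y, adj (g x) (g y) = adj x y.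
Proof.
move=> Us all_s Ut Cst.
have Est : size t = size s by rewrite -(size_code_of (@adj G)) Cst size_code_of.
case: t => [|y0 t0] in Ut Cst Est *.
  have F0 (x : F) : False by have := all_s x; rewrite (size0nil (esym Est)).
  by exists (fun x => match F0 x with end) => x; case: (F0 x).
set t := y0 :: t0 in Ut Cst Est.
have lt_t x : index x s < size t by rewrite Est index_mem.
exists (fun x => nth y0 t (index x s)) => [x y /eqP|x y].
  rewrite nth_uniq // => /eqP E.
  by rewrite -(nth_index x (all_s x)) E nth_index.
rewrite -(code_adjE y0 (@adj_sym G) (@adj_irr G)) // Cst.
by rewrite (code_adjE x (@adj_sym F) (@adj_irr F)) -?Est // !nth_index.
Qed.

Lemma map_embedding (F G : sgraph) (g : F -> G) (s : seq F) :
  injective g -> (forall x y, adj (g x) (g y) = adj x y) ->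
  uniq s -> uniq (map g s) /\ code_of (@adj G) (map g s) = code_of (@adj F) s.
Proof.
move=> g_inj adj_g Us; rewrite map_inj_uniq // code_of_map; split=> //.
by apply: eq_in_code_of => x y _ _ /=.
Qed.

Lemma isub_contains F G c : has_code F c -> (isub F G <-> contains G c).
Proof.
case=> s [Us all_s <-]; split=> [/isubE[g g_inj adj_g]|[t Ut Ct]].
  by have [Ug <-] := map_embedding g_inj adj_g Us; exists (map g s).
by apply/isubE; apply: code_fun Ut Ct.
Qed.

Lemma isubP F G c d : has_code F c -> has_code G d -> reflect (isub F G) (emb c d).
Proof.
move=> Fc Gd; apply: (iffP (has_code_containsP _ Gd)); apply isub_contains; exact: Fc.
Qed.

Lemma isub_refl G : isub G G.
Proof. by apply/isubE; exists id. Qed.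

Lemma iso_refl G : iso G G.
Proof. by exists id => //; exists id. Qed.

Lemma iso_sym F G : iso F G -> iso G F.
Proof.
case=> f [f' fK f'K] adj_f; exists f' => [|x y]; first by exists f.
by rewrite -adj_f !f'K.
Qed.

Lemma iso_trans F G H : iso F G -> iso G H -> iso F H.
Proof.
case=> f f_bij adj_f [g g_bij adj_g].
by exists (g \o f) => [|x y]; [apply: bij_comp | rewrite /= adj_g].
Qed.

Lemma iso_isub F G : iso F G -> isub F G.
Proof. by case=> f /bij_inj f_inj adj_f; apply/isubE; exists f. Qed.

Lemma iso_has_code F G c : iso F G -> has_code F c -> has_code G c.
Proof.
case=> f [f' fK f'K] adj_f [s [Us all_s <-]].
have [Ug Cg] := map_embedding (can_inj fK) adj_f Us.
by exists (map f s); split=> // x; rewrite -[x]f'K map_f.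
Qed.

Lemma has_code_iso F G c : has_code F c -> has_code G c -> iso F G.
Proof.
move=> Fc Gc; have cFG : #|F| = #|G| by rewrite (has_code_card Fc) (has_code_card Gc).
case: Fc Gc => s [Us all_s <-] [t [Ut _ Ct]].
have [g g_inj adj_g] := code_fun Us all_s Ut Ct.
by exists g => //; apply: inj_card_bij; rewrite ?cFG.
Qed.

(** An embedding between graphs of equal order is onto, so the list that it provides enumerates
    [G]. *)
Lemma has_code_eqv G c d : has_code G d -> eqv c d -> has_code G c.
Proof.
move=> Gd /andP[/eqP szcd /(has_code_containsP _ Gd)[t Ut Ct]].
exists t; split=> // x.
have cT : #|t| = #|G|.
  by rewrite (card_uniqP Ut) (has_code_card Gd) -szcd -Ct size_code_of.
by rewrite ((subset_cardP cT) (subset_predT _)).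
Qed.

Lemma isoP F G c d : has_code F c -> has_code G d -> reflect (iso F G) (eqv c d).
Proof.
move=> Fc Gd; apply: (iffP idP) => [/(has_code_eqv Gd)|FG]; first exact: has_code_iso Fc.
have Gc := iso_has_code FG Fc.
rewrite /eqv -(has_code_card Gc) (has_code_card Gd) eqxx /=.
by apply/(isubP Gc Gd); apply: isub_refl.
Qed.

Lemma cocK : involutive coc.
Proof.
by move=> c; rewrite /coc -map_comp map_id_in // => r _ /=;
  rewrite -map_comp map_id_in // => b _ /=; rewrite negbK.
Qed.

Lemma code_of_co (G : sgraph) (s : seq G) :
  uniq s -> code_of (@adj (co G)) s = coc (code_of (@adj G) s).
Proof.
elim: s => //= x s IH /andP[xs Us]; rewrite IH // -map_comp; congr (_ :: _).
apply/eq_in_map=> y ys; change ((x != y) && ~~ adj x y = ~~ adj x y).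
by rewrite eq_sym (memPn xs).
Qed.

Lemma has_code_co G c : has_code G c -> has_code (co G) (coc c).
Proof. by case=> s [Us all_s <-]; exists s; rewrite code_of_co. Qed.

Lemma iso_co F G : iso F G -> iso (co F) (co G).
Proof.
case=> f f_bij adj_f; exists f => //= x y.
by rewrite adj_f (bij_eq f_bij).
Qed.

Lemma co_coK G : iso (co (co G)) G.
Proof.
exists id => [|x y /=]; first by exists id.
by case: eqP => [->|_]; rewrite ?adj_irr ?negbK.
Qed.

Lemma isub_co F G : isub F G -> isub (co F) (co G).
Proof.
case/isubE=> f f_inj adj_f; apply/isubE; exists f => //= x y.
by rewrite adj_f (inj_eq f_inj).
Qed.

(** * Codes of the named graphs *)

Fixpoint ords (n : nat) : seq 'I_n :=
  if n is m.+1 then ord0 :: map (lift ord0) (ords m) else [::].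

Lemma ords_enum n : uniq (ords n) /\ forall i, i \in ords n.
Proof.
elim: n => [|n [Un all_n]]; first by split=> // -[].
split=> /= [|i].
  rewrite map_inj_uniq ?Un ?andbT; last exact: lift_inj.
  by apply/mapP=> -[i _ /eqP]; rewrite (negPf (neq_lift _ _)).
by case: (unliftP ord0 i) => [j|] ->; rewrite inE ?eqxx ?map_f ?orbT.
Qed.

(** Expressions for the graphs named in the conditions: recursion on them yields an explicit list of
    vertices, along which the code can be evaluated. *)
Inductive gexp : Type :=
| EP of nat | EK of nat | EC of nat | EB of nat & nat | ES of nat & nat & nat
| EU of gexp & gexp | ER of nat & gexp | EO of gexp.

Fixpoint den (e : gexp) : sgraph :=
  match e with
  | EP n => Pn n
  | EK n => Kn n
  | EC n => Cn n
  | EB s t => Knm s t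
  | ES h i j => Sclaw h i j
  | EU e f => den e + den f
  | ER n e => n * den e
  | EO e => co (den e)
  end%sg.

Definition sum_seq (S T : Type) (s : seq S) (t : seq T) : seq (S + T) :=
  map inl s ++ map inr t.

Lemma sum_seq_enum (S T : eqType) (s : seq S) (t : seq T) :
  uniq s /\ (forall x, x \in s) -> uniq t /\ (forall x, x \in t) ->
  uniq (sum_seq s t) /\ forall x, x \in sum_seq s t.
Proof.
move=> [Us all_s] [Ut all_t]; split=> [|[x|x]].
- rewrite cat_uniq !map_inj_uniq ?Us ?Ut /=; try by move=> x y [].
  by rewrite andbT; apply/hasP=> -[_ /mapP[x _ ->] /mapP[]].
- by rewrite mem_cat map_f.
by rewrite mem_cat orbC map_f.
Qed.

Fixpoint vertices (e : gexp) : seq (den e) :=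
  match e with
  | EP n | EK n | EC n => ords n
  | EB s t => sum_seq (ords s) (ords t)
  | ES h i j =>
    None :: map Some (sum_seq (sum_seq (ords h) (ords i)) (ords j))
  | EU e f => sum_seq (vertices e) (vertices f)
  | ER n e => [seq (i, x) | i <- ords n, x <- vertices e]
  | EO e => vertices e
  end.

Lemma vertices_enum e : uniq (vertices e) /\ forall x, x \in vertices e.
Proof.
elim: e => [n|n|n|s t|h i j|e IHe f IHf|n e [Ue all_e]|e //];
  try exact: ords_enum.
- exact: (sum_seq_enum (ords_enum s) (ords_enum t)).
- have [Us all_s] := sum_seq_enum (sum_seq_enum (ords_enum h) (ords_enum i))
    (ords_enum j).
  split=> /= [|[x|]]; last by rewrite inE eqxx.
    rewrite map_inj_uniq ?Us ?andbT; last by move=> x y [].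
    by apply/mapP=> -[].
  by rewrite inE /= map_f.
- exact: (sum_seq_enum IHe IHf).
have [Un all_n] := ords_enum n; split=> [|[i x]].
  by apply: allpairs_uniq => // -[i x] [j y] _ _ [-> ->].
by apply/allpairsP; exists (i, x).
Qed.

Definition ecode (e : gexp) : code := code_of (@adj (den e)) (vertices e).

Lemma has_code_den e : has_code (den e) (ecode e).
Proof. by have [Ue all_e] := vertices_enum e; exists (vertices e). Qed.

(** * The conditions as computations on small graphs *)

Declare Scope gexp_scope.
Delimit Scope gexp_scope with gx.
Bind Scope gexp_scope with gexp.
Notation "e + f" := (EU e f) : gexp_scope.
Notation "n * e" := (ER n%N e) : gexp_scope.

Definition codes (tab : seq (gexp * gexp)) : seq (code * code) :=
  [seq (ecode xy.1, ecode xy.2) | xy <- tab].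

(** The cases of (A) that bound both graphs by fixed graphs; those on [P_4] and on [K_s], [tP_1] are
    tested directly in [Ab]. *)
Definition tableA : seq (gexp * gexp) :=
  let paw := EO (EP 1 + EP 3) in
  let diamond := EO (2 * EP 1 + EP 2) in
  let gem := EO (EP 1 + EP 4) in
  [:: (paw, EB 1 3 + 3 * EP 1); (paw, EB 1 3 + EP 2);
      (paw, EP 1 + EP 2 + EP 3); (paw, EP 1 + EP 5); (paw, EP 1 + ES 1 1 2);
      (paw, EP 2 + EP 4); (paw, EP 6); (paw, ES 1 1 3); (paw, ES 1 2 2);
      (diamond, EP 1 + 2 * EP 2); (diamond, 3 * EP 1 + EP 2);
      (diamond, EP 2 + EP 3);
      (gem, EP 1 + EP 4); (gem, EP 5);
      (EK 3 + EP 1, EB 1 3);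
      (EO (2 * EP 1 + EP 3), 2 * EP 1 + EP 3)]%gx.

Definition tableB : seq (gexp * gexp) :=
  [:: (EP 6, EO (2 * EP 2)); (2 * EP 2, EO (EP 2 + EP 3))]%gx.

(** The cases of (C) on containment; the two on membership in S and in its complement class are
    handled by proof. *)
Definition tableC : seq (gexp * gexp) :=
  let diamond := EO (2 * EP 1 + EP 2) in
  let gem := EO (EP 1 + EP 4) in
  [:: (EK 3 + EP 1, 4 * EP 1); (EK 3 + EP 1, 2 * EP 2);
      (diamond, EB 1 3); (diamond, 5 * EP 1); (diamond, EP 2 + EP 4);
      (EK 3, 2 * EP 1 + 2 * EP 2); (EK 3, 2 * EP 1 + EP 4);
      (EK 3, 4 * EP 1 + EP 2); (EK 3, 3 * EP 2); (EK 3, 2 * EP 3);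
      (EK 4, EP 1 + EP 4); (EK 4, 3 * EP 1 + EP 2); (EK 4, 2 * EP 2);
      (gem, EP 1 + 2 * EP 2)]%gx.

Definition tableD : seq (gexp * gexp) :=
  let diamond := EO (2 * EP 1 + EP 2) in
  let gem := EO (EP 1 + EP 4) in
  [:: (diamond, EP 1 + EP 6); (2 * EP 1 + EP 2, EO (EP 6)); (gem, EP 6);
      (EP 1 + 2 * EP 2, EO (EP 1 + 2 * EP 2));
      (EP 1 + 2 * EP 2, EO (EP 2 + EP 3));
      (EP 6, EO (EP 1 + 2 * EP 2)); (EP 6, EO (EP 2 + EP 3));
      (2 * EP 2, EO (EP 2 + EP 4)); (2 * EP 2, EO (3 * EP 2));
      (2 * EP 2, EO (EP 5))]%gx.

Definition tableE : seq (gexp * gexp) :=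
  let diamond := EO (2 * EP 1 + EP 2) in
  let gem := EO (EP 1 + EP 4) in
  [:: (diamond, EP 6);
      (EC 4, EP 1 + 2 * EP 2); (EC 4, EP 2 + EP 4); (EC 4, 3 * EP 2);
      (EO (EP 1 + 2 * EP 2), 2 * EP 2); (EO (EP 1 + 2 * EP 2), EP 2 + EP 3);
      (EO (EP 1 + 2 * EP 2), EP 5);
      (EO (EP 2 + EP 3), EP 2 + EP 3); (EO (EP 2 + EP 3), EP 5);
      (EK 3, EP 1 + ES 1 1 3); (EK 3, ES 1 2 3);
      (3 * EP 1, EO (EP 1 + ES 1 1 3));
      (diamond, EP 1 + EP 2 + EP 3); (diamond, EP 1 + EP 5);
      (2 * EP 1 + EP 2, EO (EP 1 + EP 2 + EP 3));
      (2 * EP 1 + EP 2, EO (EP 1 + EP 5));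
      (gem, EP 2 + EP 3);
      (EP 1 + EP 4, EO (EP 2 + EP 3))]%gx.

Definition codesA := codes tableA.
Definition codesB := codes tableB.
Definition codesC := codes tableC.
Definition codesD := codes tableD.
Definition codesE := codes tableE.

Definition subb (tab : seq (code * code)) (c d : code) : bool :=
  lazy_has (fun xy => emb c xy.1 &&& emb d xy.2) tab.

Definition supb (tab : seq (code * code)) (c d : code) : bool :=
  lazy_has (fun xy => emb xy.1 c &&& emb xy.2 d) tab.

Definition sameb (c d x y : code) : bool :=
  (eqv c x &&& eqv d y) ||| (eqv c y &&& eqv d x).

Definition edgeless : pred code := all (all negb).

Definition code_P4 := ecode (EP 4).
Definition code_3P1 := ecode (3 * EP 1).
Definition code_2P2 := ecode (2 * EP 2).
Definition code_P1P3 := ecode (EP 1 + EP 3).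
Definition code_K14 := ecode (EB 1 4).
Definition code_coS123 := ecode (EO (ES 1 2 3)).

(* Two adjacent vertices of degree 3. *)
Definition code_double_claw : code :=
  [:: [:: true; true; true; false; false]; [:: false; false; false; false];
      [:: false; false; false]; [:: true; true]; [:: false]; [::]].

Definition Ab (c d : code) : bool :=
  (emb c code_P4 ||| emb d code_P4)
  ||| [&& 0 < size c, 0 < size d, edgeless (coc c) & edgeless d]
  ||| subb codesA c d.

(** An inclusion between two such classes amounts to this: each graph forbidden in the larger class
    contains one that is forbidden in the smaller class. The same holds for [Db]. *)
Definition Bb (c d : code) : bool :=
  lazy_has (fun xy => (emb c xy.1 ||| emb d xy.1) &&&
                      (emb c xy.2 ||| emb d xy.2)) codesB.

Definition Db (c d : code) : bool :=
  lazy_has (fun xy => (emb xy.1 c ||| emb xy.2 c) &&&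
                      (emb xy.1 d ||| emb xy.2 d)) codesD.

Definition Eb (c d : code) : bool :=
  lazy_has (fun xy => sameb c d xy.1 xy.2) codesE.

(* Unlike in [Ab], [Bb], [Db] and [Eb], here [c] stands for the complement of the
   first graph of the pair. *)
Definition Cb (c d : code) : bool :=
  supb codesC (coc c) d ||| supb codesC (coc d) c.

(* Every graph in S outside of the induced subgraphs of P_4 contains 3P_1 or 2P_2,
   so in a pair with such a graph a rich graph satisfies (C). *)
Definition rich (c : code) : bool := Cb c code_3P1 &&& Cb c code_2P2.

(** [K_{1,4}] and the double claw never occur in a graph in S, and a rich graph is settled at once.
    All three tests persist when vertices are added, so the enumeration may drop a graph as soon as
    one of them succeeds. *)
Definition excluded (c : code) : bool :=
  emb code_K14 c ||| emb code_double_claw c ||| rich c.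

(** * Enumeration of forests by adding vertices of degree at most 1 *)

Fixpoint leaf_rows (n : nat) : seq (seq bool) :=
  if n is m.+1 then (true :: nseq m false) :: map (cons false) (leaf_rows m)
  else [:: [::]].

(** A cheap isomorphism invariant, compared before [eqv] to spare most searches. *)
Definition degree_counts (c : code) : seq nat :=
  let u := iota 0 (size c) in
  [seq count (fun i => count (code_adj c i) u == k) u | k <- iota 0 4].

Definition reps (p : pred code) (cs : seq code) : seq code :=
  foldr (fun c ds =>
    if p c ||| lazy_has (fun d =>
         (degree_counts d == degree_counts c) &&& eqv d c) ds
    then ds else c :: ds) [::] cs.

Definition grow (p : pred code) (cs : seq code) : seq code :=
  reps p [seq r :: c | c <- cs, r <- leaf_rows (size c)].

Definition forests (p : pred code) (n : nat) : seq code :=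
  flatten (traject (grow p) [:: [::]] n).

(* On 8 vertices only the edgeless graph is left by [forests excluded]; it stands
   for all edgeless graphs on at least 8 vertices. *)
Definition pair_ok (c d : code) : bool :=
  (emb c code_P4 ||| emb d code_P4)
  ||| Cb c d ||| Db (coc c) d
  ||| (eqv c code_P1P3 ||| eqv d code_P1P3)
  ||| (edgeless c &&& edgeless d)
  ||| ((size c < 8) &&& (size d < 8) &&&
       (Ab (coc c) d ||| Ab (coc d) c ||| Bb (coc c) d ||| Eb (coc c) d
        ||| sameb (coc c) d code_3P1 code_coS123)).

(** The bound 9 yields the graphs on 0 to 8 vertices. [Cb] and [Db] persist in larger graphs, so in
    [pair_ok] they may be tested on codes that are merely contained in the actual graphs. The tests
    against [P_4] and [P_1+P_3] bound the order by themselves; the last group needs the exact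
    graphs, hence its condition on the sizes. *)
Lemma small_pairs_ok :
  let small := forests excluded 9 in all (fun c => all (pair_ok c) small) small.
Proof. by vm_compute. Qed.

Lemma leaf_rowsP n (r : seq bool) :
  size r = n -> count id r <= 1 -> r \in leaf_rows n.
Proof.
elim: n r => [|n IH] [|b r] //= [sz]; rewrite inE; case: b => /= le1.
  rewrite (@all_pred1P _ false r _) ?sz ?eqxx //.
  apply/allP=> -[] // r_true; move: le1.
  by rewrite add1n ltnS leqn0 eqn0Ngt -has_count (introT hasP) //; exists true.
by rewrite map_f ?orbT // IH.
Qed.

Lemma repsP (p : pred code) cs c :
  c \in cs -> p c \/ exists2 d, d \in reps p cs & (d == c) || eqv d c.
Proof.
elim: cs => //= c' cs IH; rewrite inE => /predU1P[<-|/IH[pc|[d dcs dc]]].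
- case: ifP => [|_]; last by right; exists c; rewrite ?mem_head ?eqxx.
  case: ifP => [|_]; [by left | rewrite lazy_hasE => /hasP[d dcs]].
  by case: ifP => // _ dc; right; exists d; rewrite // dc orbT.
- by left.
by right; exists d => //; case: ifP; rewrite // inE dcs orbT.
Qed.

(** Forests: every non-empty induced subgraph has a vertex of degree at most 1. This is the vertex
    that the enumeration adds last. *)
Definition acyclic (G : sgraph) : Prop :=
  forall s : seq G, uniq s -> s != [::] ->
    exists2 x, x \in s & count (adj x) s <= 1.

(** Upward closed: it is the failure of [p] that passes to induced subgraphs. *)
Definition hereditary (G : sgraph) (p : pred code) : Prop :=
  forall s t : seq G, uniq s -> uniq t -> {subset s <= t} ->
    p (code_of (@adj G) s) -> p (code_of (@adj G) t).

(** Completeness of the enumeration, by induction on the number of vertices: remove a vertex of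
    degree at most 1, list the rest, and put the vertex back in front with a row from [leaf_rows].
    If the rest satisfies [p], so does the whole. *)
Lemma acyclic_codes (G : sgraph) (p : pred code) (s : seq G) :
  acyclic G -> hereditary G p -> uniq s ->
  p (code_of (@adj G) s) \/
  exists2 t, perm_eq t s &
    code_of (@adj G) t \in iter (size s) (grow p) [:: [::]].
Proof.
move=> acG hered; move En: (size s) => n.
elim: n s En => [|n IH] s; first by case: s => // _ _; right; exists [::].
move=> sz Us; have [|x xs le1] := acG s Us; first by case: (s) sz.
have ss1 := perm_to_rem xs; set s1 := rem x s in ss1.
have Us1 : uniq s1 by apply: rem_uniq.
have [|ps1|[t1 ts1 lev]] := IH s1 _ Us1; first by rewrite size_rem // sz.
  by left; apply: hered ps1 => // y /mem_rem.
have xts : perm_eq (x :: t1) s.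
  by rewrite perm_sym; apply: perm_trans ss1 _; rewrite perm_cons perm_sym.
have Uxt : uniq (x :: t1) by rewrite (perm_uniq xts).
set e := code_of (@adj G) (x :: t1).
have [|pe|[d dlev /predU1P[Ed|/andP[/eqP szd]]]] := @repsP p
    [seq r :: c | c <- iter n (grow p) [:: [::]], r <- leaf_rows (size c)] e.
- apply/allpairsPdep; exists (code_of (@adj G) t1), [seq adj x y | y <- t1].
  split=> //; apply: leaf_rowsP; rewrite ?size_map ?size_code_of // count_map.
  apply: leq_trans le1; rewrite -(permP xts) /= -[X in X <= _]add0n leq_add2r.
  exact: leq0n.
- by left; apply: hered pe => // y; rewrite (perm_mem xts).
- by right; exists (x :: t1); rewrite // -/e -Ed.
(* The representative [d] that was kept has as many vertices, so it is the code of the same vertices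
   in another order. *)
case/(embP _ (@adj_sym G) (@adj_irr G) Uxt) => t [Ut tsub Ct].
right; exists t; rewrite ?Ct //; apply: perm_trans xts.
apply: uniq_perm => //.
have [] // := uniq_min_size Ut tsub.
by rewrite -(size_code_of (@adj G) t) Ct szd size_code_of.
Qed.

Lemma forests_mem p n m c :
  c \in iter m (grow p) [:: [::]] -> m < n -> c \in forests p n.
Proof.
move=> lev lt_mn; apply/flattenP; exists (iter m (grow p) [:: [::]]) => //.
by apply/trajectP; exists m.
Qed.

(** * Graphs in S *)

(* The positions of the vertices of a subdivided claw or a path: the distance
   [d] to the centre (or to an end), and the leg [a] outside of the centre. *)
Record spider (G : sgraph) (D : pred G) (d a : G -> nat) : Prop := Spider {
  spider_closed : forall x y, D x -> adj x y -> D y;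
  spider_step : forall x y, D x -> adj x y -> d y = (d x).+1 \/ d x = (d y).+1;
  spider_leg : forall x y, D x -> adj x y -> 0 < d x -> 0 < d y -> a x = a y;
  spider_inj : forall x y, D x -> D y -> d x = d y -> (0 < d x -> a x = a y) ->
    x = y;
  spider_legs : forall x, a x < 3 }.

Lemma adj_Pn n (i j : Pn n) : adj i j = (i.+1 == j :> nat) || (j.+1 == i :> nat).
Proof.
by rewrite /=; case: eqP => //= ->; rewrite orbb eqn_leq ltnn.
Qed.

Lemma Pn_spider n : spider (G := Pn n) predT (@nat_of_ord n) (fun=> 0).
Proof.
split=> // [x y _|x y _ _ dxy _]; last exact: val_inj.
by rewrite adj_Pn => /orP[]/eqP <-; [left | right].
Qed.

Definition claw_dist h i j (x : Sclaw h i j) : nat :=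
  match x with
  | None => 0
  | Some (inl (inl k)) => (k : 'I_h).+1
  | Some (inl (inr k)) => (k : 'I_i).+1
  | Some (inr k) => (k : 'I_j).+1
  end.

Definition claw_leg h i j (x : Sclaw h i j) : nat :=
  match x with Some (inl (inr _)) => 1 | Some (inr _) => 2 | _ => 0 end.

Lemma adj_Sclaw h i j (x y : Sclaw h i j) :
  adj x y = match x, y with
    | None, None => false
    | None, Some _ => claw_dist y == 1
    | Some _, None => claw_dist x == 1
    | Some u, Some v => adj u v
    end.
Proof.
case: x y => [x|] [y|] //=.
- rewrite [X in _ || X](@adj_sym (Pn h + Pn i + Pn j)%sg) orbb.
  case: eqP => // -[->]; exact/esym/(@adj_irr (Pn h + Pn i + Pn j)%sg).
- by case: x => [[]|].
by case: y => [[]|] k; rewrite ?orbF.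
Qed.

Lemma Sclaw_spider h i j :
  spider (G := Sclaw h i j) predT (@claw_dist h i j) (@claw_leg h i j).
Proof.
have step n (k l : Pn n) : adj k l -> l.+1 = k.+2 \/ k.+1 = l.+2.
  by rewrite adj_Pn => /orP[]/eqP <-; [left | right].
split=> //.
- move=> [x|] [y|] _; rewrite adj_Sclaw //; last by move/eqP=> ->; left.
    by move: x y => [[x|x]|x] [[y|y]|y] //; apply: step.
  by move/eqP=> ->; right.
- by move=> [x|] [y|] _ //; rewrite adj_Sclaw //; move: x y => [[x|x]|x] [[y|y]|y].
- by move=> [[[x|x]|x]|] [[[y|y]|y]|] _ _ //= + /(_ isT) // => -[/ord_inj ->].
by move=> [[[x|x]|x]|].
Qed.

Lemma component_spider (G T : sgraph) (x : G) d a :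
  iso (component x) T -> spider (G := T) predT d a ->
  exists d' a', spider (G := G) (connect (@adj G) x) d' a'.
Proof.
case=> f /bij_inj f_inj adj_f spT.
(* The value 0 outside of the component is harmless: there only the bound on the legs has to
   hold. *)
pose pos (h : T -> nat) y :=
  if insub y is Some u then h (f (u : component x)) else 0.
have posE y : connect (@adj G) x y ->
    exists u : component x, val u = y /\ forall h, pos h y = h (f u).
  move=> xy; have yx : y \in [set z | connect (@adj G) x z] by rewrite inE.
  by exists (Sub y yx); split=> // h; rewrite /pos insubT.
have closed y z : connect (@adj G) x y -> adj y z -> connect (@adj G) x z.
  by move=> xy yz; apply: connect_trans xy (connect1 yz).
have lift_adj y z : connect (@adj G) x y -> adj y z -> exists u v : component x,
    [/\ forall h, pos h y = h (f u), forall h, pos h z = h (f v)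
      & adj (f u) (f v)].
  move=> xy yz; have [u [uy posu]] := posE y xy.
  have [v [vz posv]] := posE z (closed _ _ xy yz).
  by exists u, v; split=> //; rewrite adj_f /= uy vz.
exists (pos d), (pos a); split=> //.
- move=> y z xy yz; have [u [v [-> -> uv]]] := lift_adj y z xy yz.
  exact: (spider_step spT isT uv).
- move=> y z xy yz; have [u [v [posu posv uv]]] := lift_adj y z xy yz.
  by rewrite !posu !posv; apply: (spider_leg spT isT uv).
- move=> y z /posE[u [uy posu]] /posE[v [vz posv]].
  rewrite !posu !posv -uy -vz => dE aE; congr val.
  exact/f_inj/(spider_inj spT isT isT).
move=> y; rewrite /pos; case: insub => // u; exact: (spider_legs spT).
Qed.

Lemma in_S_spider (G : sgraph) (x : G) :
  in_S G -> exists d a, spider (G := G) (connect (@adj G) x) d a.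
Proof.
move=> /(_ x)[[t _ isoT]|[h [i [j [_ [_ isoT]]]]]].
  exact: component_spider isoT (Pn_spider t).
exact: component_spider isoT (@Sclaw_spider h i j).
Qed.

(** Among the vertices of [s] in one component, take one at maximal distance. Its neighbours in [s]
    lie one step closer, on the same leg or at the centre, so there is at most one. *)
Lemma in_S_acyclic G : in_S G -> acyclic G.
Proof.
move=> GS s Us; case: s Us => // x0 s0; set s := x0 :: s0 => Us _.
have [d [a sp]] := in_S_spider x0 GS.
pose P : pred G := fun y => (y \in s) && connect (@adj G) x0 y.
have x0P : P x0 by rewrite /P mem_head connect0.
case: (arg_maxnP d x0P) => x /andP[xs Dx] d_max; exists x => //.
have below y : y \in filter (adj x) s -> [/\ connect (@adj G) x0 y, adj x y & d x = (d y).+1].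
  rewrite mem_filter => /andP[xy ys].
  have Dy := spider_closed sp Dx xy; split=> //.
  have dyx : d y <= d x by apply: d_max; rewrite /P ys.
  by case: (spider_step sp Dx xy) dyx => // ->; rewrite /= ltnn.
rewrite -size_filter; case Ef: (filter _ s) below (filter_uniq (adj x) Us) => [|y [|z t]] //= below.
have [] := below y; first exact: mem_head.
have [] := below z; first by rewrite !inE eqxx orbT.
move=> Dz xz dz Dy xy dy; rewrite (_ : y = z) ?mem_head //.
have dyz : d y = d z by apply: succn_inj; rewrite -dy.
apply: (spider_inj sp Dy Dz) => // dy0; have dz0 : 0 < d z by rewrite -dyz.
have dx0 : 0 < d x by rewrite dy.
by rewrite -(spider_leg sp Dx xy) // -(spider_leg sp Dx xz).
Qed.

(** Outside of the centre, the neighbours of a vertex lie at one of two distances, and neighbours at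
    equal distance coincide, so there are at most two. *)
Lemma spider_degree3 (G : sgraph) (D : pred G) d a x (y1 y2 y3 : G) :
  spider D d a -> D x -> adj x y1 -> adj x y2 -> adj x y3 ->
  uniq [:: y1; y2; y3] -> d x = 0.
Proof.
move=> sp Dx x1 x2 x3 Uy; apply/eqP; rewrite -leqn0 leqNgt; apply/negP=> dx0.
have eqy y z : adj x y -> adj x z -> d y = d z -> y = z.
  move=> xy xz dE.
  apply: (spider_inj sp (spider_closed sp Dx xy) (spider_closed sp Dx xz)) => //.
  move=> dy0; have dz0 : 0 < d z by rewrite -dE.
  by rewrite -(spider_leg sp Dx xy) // -(spider_leg sp Dx xz).
move: Uy; rewrite /= !inE.
have d1 := spider_step sp Dx x1; have d2 := spider_step sp Dx x2.
have d3 := spider_step sp Dx x3.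
have : d y1 = d y2 \/ d y1 = d y3 \/ d y2 = d y3.
  by case: d1 d2 d3 => d1 [] d2 [] d3;
    [left|left|right; left|right; right|right; right|right; left|left|left];
    congruence.
case=> [/(eqy _ _ x1 x2)|[/(eqy _ _ x1 x3)|/(eqy _ _ x2 x3)]] ->;
  by rewrite eqxx ?orbT ?andbF.
Qed.

(** A vertex with four neighbours would be the centre, and its neighbours would begin four distinct
    legs. *)
Lemma in_S_no_K14 G : in_S G -> ~ contains G code_K14.
Proof.
move=> GS [s Us]; move: Us; case: s => [|x [|y1 [|y2 [|y3 [|y4 [|? ?]]]]]] //.
rewrite cons_uniq => /andP[_ Uy] [x1 x2 x3 x4 _ _ _ _ _ _].
have [d [a sp]] := in_S_spider x GS; have Dx := connect0 (@adj G) x.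
have dx := spider_degree3 sp Dx x1 x2 x3 (mask_uniq Uy [:: true; true; true]).
have nbr y : y \in [:: y1; y2; y3; y4] -> adj x y.
  by rewrite !inE => /or4P[]/eqP->.
have d1 y : y \in [:: y1; y2; y3; y4] -> d y = 1.
  by move=> /nbr xy; case: (spider_step sp Dx xy); rewrite dx.
have Ua : uniq (map a [:: y1; y2; y3; y4]).
  rewrite map_inj_in_uniq // => y z yin zin ayz.
  apply: (spider_inj sp (spider_closed sp Dx (nbr y yin))
    (spider_closed sp Dx (nbr z zin))) => //.
  by rewrite !d1.
have /(uniq_leq_size Ua) : {subset map a [:: y1; y2; y3; y4] <= iota 0 3}.
  by move=> _ /mapP[y _ ->]; rewrite mem_iota (spider_legs sp).
by [].
Qed.

(** Both vertices of degree 3 would be at distance 0, but the distances of adjacent vertices differ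
    by 1. *)
Lemma in_S_no_double_claw G : in_S G -> ~ contains G code_double_claw.
Proof.
move=> GS [s Us]; move: Us.
case: s => [|x [|x1 [|x2 [|y [|y1 [|y2 [|? ?]]]]]]] // Us.
case=> xx1 xx2 xy _ _ _ _ _ _ _ _ _ yy1 yy2 _.
have [d [a sp]] := in_S_spider x GS; have Dx := connect0 (@adj G) x.
have Dy := spider_closed sp Dx xy.
have dx := spider_degree3 sp Dx xx1 xx2 xy
  (mask_uniq Us [:: false; true; true; true]).
have yx : adj y x by rewrite adj_sym.
have dy := spider_degree3 sp Dy yx yy1 yy2
  (mask_uniq Us [:: true; false; false; false; true; true]).
by case: (spider_step sp Dx xy); rewrite dx dy.
Qed.

(** * Graph expressions that denote graphs in S *)

Inductive leggy : sgraph -> Prop :=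
| leggy_path t : 0 < t -> leggy (Pn t)
| leggy_claw h i j : 0 < h <= i -> i <= j -> leggy (Sclaw h i j).

Lemma connect_descent (T : sgraph) (r : T) (d : T -> nat) :
  (forall u, u != r -> exists2 v, adj u v & d v < d u) ->
  forall u v, connect (@adj T) u v.
Proof.
move=> desc; have toR u : connect (@adj T) u r.
  have [n] := ubnP (d u); elim: n u => // n IH u dun.
  have [->|/desc[v uv dvu]] := eqVneq u r; first exact: connect0.
  by apply: connect_trans (connect1 uv) (IH v (leq_trans dvu dun)).
move=> u v; apply: connect_trans (toR u) _.
by rewrite (sym_connect_sym (@adj_sym T)).
Qed.

Lemma leggy_connected T : leggy T -> forall u v : T, connect (@adj T) u v.
Proof.
have pred_lt n (k : Pn n) : 0 < k -> exists2 l : Pn n, adj k l & k = l.+1 :> nat.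
  case: k => -[|k] lt_kn // _; exists (Ordinal (ltnW lt_kn)) => //.
  by rewrite adj_Pn /= eqxx orbT.
case=> [[|t] // _|h i j _ _].
  apply: (@connect_descent (Pn t.+1) ord0 (@nat_of_ord t.+1)) => u u0.
  have [|v uv ->] := @pred_lt t.+1 u; last by exists v.
  by rewrite lt0n.
apply: (@connect_descent (Sclaw h i j) None (@claw_dist h i j)) => -[u|] // _.
have [u1|u1] := boolP (claw_dist (Some u : Sclaw h i j) == 1).
  by exists None; rewrite ?adj_Sclaw // (eqP u1).
have step n (k : Pn n) : k.+1 != 1 -> exists2 l : Pn n, adj k l & l.+1 < k.+1.
  by rewrite eqSS -lt0n => /pred_lt[l kl ->]; exists l.
case: u u1 => [[u|u]|u] /step[v uv dv].
- by exists (Some (inl (inl v))); rewrite ?adj_Sclaw.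
- by exists (Some (inl (inr v))); rewrite ?adj_Sclaw.
by exists (Some (inr v)); rewrite ?adj_Sclaw.
Qed.

(** A certificate for membership in S that avoids computing components: each vertex lies in an
    induced copy of a path or a subdivided claw that no edge leaves. In this form it passes easily
    to disjoint unions. *)
Definition leggy_parts (G : sgraph) : Prop :=
  forall x : G, exists2 T, leggy T & exists g : T -> G,
    [/\ injective g, forall u v, adj (g u) (g v) = adj u v,
        forall u y, adj (g u) y -> exists v, y = g v & exists u, x = g u].

(** The image of [T] is closed under adjacency, hence contains the component of [x]; it is
    connected, hence is contained in it. *)
Lemma leggy_parts_in_S G : leggy_parts G -> in_S G.
Proof.
move=> Gparts x; have [T legT [g [g_inj adj_g g_closed [u xu]]]] := Gparts x.
have img y : connect (@adj G) x y -> y \in codom g.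
  have cl : closed (@adj G) (codom g).
    apply: (intro_closed (sym_connect_sym (@adj_sym G))) => z w zw /codomP[v zv].
    have [u' ->] : exists u', w = g u' by apply: (g_closed v); rewrite -zv.
    exact: codom_f.
  by move/(closed_connect cl) <-; rewrite xu codom_f.
have conn v : g v \in [set y | connect (@adj G) x y].
  rewrite inE xu; have /connectP[p] := leggy_connected legT u v.
  elim: p u {xu} => [|w p IH] u /= => [_ ->|/andP[uw pw] Ev]; first exact: connect0.
  by apply: connect_trans (IH w pw Ev); apply: connect1; rewrite adj_g.
have isoT : iso (component x) T.
  apply: iso_sym; exists (fun v => exist _ (g v) (conn v)) => //.
  apply: inj_card_bij => [v w [/g_inj //]|].
  rewrite card_sig -(card_codom g_inj); apply/subset_leq_card/subsetP=> y.
  by rewrite inE => /img.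
case: T / legT g g_inj adj_g g_closed u xu img conn isoT
  => [t t0|h i j hi ij] g _ _ _ _ _ _ _ isoT; [left | right].
  by exists t.
by exists h, i, j.
Qed.

Lemma leggy_leggy_parts T : leggy T -> leggy_parts T.
Proof.
by move=> legT x; exists T => //; exists id; split=> // [u y _|]; [exists y|exists x].
Qed.

Lemma leggy_parts_iso F G : iso F G -> leggy_parts F -> leggy_parts G.
Proof.
case=> f [f' fK f'K] adj_f Fparts x.
have [T legT [g [g_inj adj_g g_closed [u xu]]]] := Fparts (f' x).
exists T => //; exists (f \o g); split=> [|v w|v y|].
- exact: inj_comp (can_inj fK) g_inj.
- by rewrite /= adj_f.
- rewrite /= -[y]f'K adj_f => /g_closed[w ->]; by exists w.
by exists u; rewrite /= -xu f'K.
Qed.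

Lemma leggy_parts_union F G :
  leggy_parts F -> leggy_parts G -> leggy_parts (F + G)%sg.
Proof.
move=> Fparts Gparts [x|x].
  have [T legT [g [g_inj adj_g g_closed [u xu]]]] := Fparts x.
  exists T => //; exists (inl \o g); split=> // [v w [/g_inj] //|v [y|y] //|].
    by case/g_closed=> w ->; exists w.
  by exists u; rewrite xu.
have [T legT [g [g_inj adj_g g_closed [u xu]]]] := Gparts x.
exists T => //; exists (inr \o g); split=> // [v w [/g_inj] //|v [y|y] //|].
  by case/g_closed=> w ->; exists w.
by exists u; rewrite xu.
Qed.

Lemma leggy_parts_copies r G : leggy_parts G -> leggy_parts (r * G)%sg.
Proof.
move=> Gparts [i x].
have [T legT [g [g_inj adj_g g_closed [u xu]]]] := Gparts x.
exists T => //; exists (fun v => (i, g v)).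
split=> // [v w [/g_inj] //|v w|v [j y]|].
- by rewrite -adj_g /= eqxx.
- by rewrite /= => /andP[/eqP <- /g_closed[w ->]]; exists w.
by exists u; rewrite xu.
Qed.

Fixpoint leggy_exp (e : gexp) : bool :=
  match e with
  | EP n => 0 < n
  | ES h i j => (0 < h <= i) && (i <= j)
  | EU e f => leggy_exp e && leggy_exp f
  | ER _ e => leggy_exp e
  | _ => false
  end.

Lemma leggy_exp_in_S e G : leggy_exp e -> iso G (den e) -> in_S G.
Proof.
move=> leg_e /iso_sym Ge; apply/leggy_parts_in_S/(leggy_parts_iso Ge) => {G Ge}.
elim: e leg_e => //= [n n0|h i j /andP[hi ij]|e IHe f IHf /andP[/IHe ? /IHf]|n e IH /IH].
- exact/leggy_leggy_parts/leggy_path.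
- exact/leggy_leggy_parts/leggy_claw.
- exact: leggy_parts_union.
exact: leggy_parts_copies.
Qed.

(** * The conditions reflected by boolean tests *)

Definition sub_pair (tab : seq (gexp * gexp)) (F G : sgraph) : Prop :=
  List.Exists (fun xy => isub F (den xy.1) /\ isub G (den xy.2)) tab.

Definition sup_pair (tab : seq (gexp * gexp)) (F G : sgraph) : Prop :=
  List.Exists (fun xy => isub (den xy.1) F /\ isub (den xy.2) G) tab.

Lemma Exists_hasP T (P : T -> Prop) (a : pred T) s :
  (forall x, P x <-> a x) -> List.Exists P s <-> has a s.
Proof.
move=> Pa; elim: s => [|x s IH] /=; first by rewrite List.Exists_nil.
by rewrite List.Exists_cons IH Pa; split=> /orP.
Qed.

Lemma has_codes (a : pred (code * code)) tab :
  lazy_has a (codes tab) = has (fun xy => a (ecode xy.1, ecode xy.2)) tab.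
Proof. by rewrite lazy_hasE has_map. Qed.

Lemma iff_andb (P Q : Prop) (p q : bool) :
  P <-> p -> Q <-> q -> P /\ Q <-> p && q.
Proof. by move=> -> ->; split=> /andP. Qed.

Lemma iff_orb (P Q : Prop) (p q : bool) :
  P <-> p -> Q <-> q -> P \/ Q <-> p || q.
Proof. by move=> -> ->; split=> /orP. Qed.

Section Reflection.
Variables (F G : sgraph) (c d : code).
Hypotheses (Fc : has_code F c) (Gd : has_code G d).

Lemma subbP tab : sub_pair tab F G <-> subb (codes tab) c d.
Proof.
rewrite /subb has_codes; apply: Exists_hasP => -[e f].
apply: iff_andb; apply: rwP; apply: isubP => //; exact: has_code_den.
Qed.

Lemma supbP tab : sup_pair tab F G <-> supb (codes tab) c d.
Proof.
rewrite /supb has_codes; apply: Exists_hasP => -[e f].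
apply: iff_andb; apply: rwP; apply: isubP => //; exact: has_code_den.
Qed.

Lemma samebP X Y x y :
  has_code X x -> has_code Y y -> same_pair F G X Y <-> sameb c d x y.
Proof.
by move=> Xx Yy; apply: iff_orb; apply: iff_andb; apply: rwP; apply: isoP.
Qed.

End Reflection.

(** If [X] contains neither [F] nor [G], then [X] itself is in the first class but not in the
    second; likewise for [Y]. Containment being decidable, this yields the disjunctions. *)
Lemma subclassE F G X Y : subclass (free F G) (free X Y) <->
  (isub F X \/ isub G X) /\ (isub F Y \/ isub G Y).
Proof.
have free_not H : ~ (isub F H \/ isub G H) -> free F G H.
  by move=> nFGH; split=> ?; apply: nFGH; [left | right].
have dec H : (isub F H \/ isub G H) \/ ~ (isub F H \/ isub G H).
  have decK K : isub K H \/ ~ isub K H.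
    by case: (isubP (has_code_enum K) (has_code_enum H)); [left | right].
  by have := decK F; have := decK G; tauto.
split=> [sub|[FGX FGY] H [nF nG]].
  split; [have [//|/free_not/sub[nX _]] := dec X
         |have [//|/free_not/sub[_ nY]] := dec Y].
    by case: nX; apply: isub_refl.
  by case: nY; apply: isub_refl.
split=> XH; [case: FGX | case: FGY] => /isub_trans/(_ XH) //.
Qed.

Lemma edgeless_code_of (G : sgraph) (s : seq G) :
  edgeless (code_of (@adj G) s) <-> {in s &, forall x y, ~~ adj x y}.
Proof.
elim: s => //= x s IH; split=> [/andP[xs /IH sP] y z|sP].
  have xsP y' : y' \in s -> ~~ adj x y'.
    by move=> ys; move: xs; rewrite all_map => /allP; apply.
  rewrite !inE => /predU1P[->|ys] /predU1P[->|zs].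
  - by rewrite adj_irr.
  - exact: xsP.
  - by rewrite adj_sym xsP.
  exact: sP.
apply/andP; split; last first.
  by apply/IH => y z ys zs; apply: sP; rewrite inE (ys, zs) orbT.
rewrite all_map; apply/allP=> y ys; apply: sP; rewrite inE ?eqxx //.
by rewrite ys orbT.
Qed.

Lemma edgelessP G c :
  has_code G c -> edgeless c <-> forall x y : G, ~~ adj x y.
Proof.
case=> s [_ all_s <-].
rewrite edgeless_code_of.
by split=> [sP x y|sP x y _ _]; [apply: sP | apply: sP].
Qed.

Lemma eq_card_bij (S T : finType) :
  #|S| = #|T| -> exists f : S -> T, bijective f.
Proof.
move=> cST; exists (fun x => enum_val (cast_ord cST (enum_rank x))).
exists (fun y => enum_val (cast_ord (esym cST) (enum_rank y))) => x;
  by rewrite enum_valK ?cast_ordK ?cast_ordKV enum_rankK.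
Qed.

(** With [iso_Kn], this turns the infinite family of pairs [K_s], [tP_1] in (A) into a test on the
    two given graphs. *)
Lemma iso_copies_P1 G n :
  iso G (n * Pn 1)%sg <-> #|G| = n /\ forall x y : G, ~~ adj x y.
Proof.
have no_edge (u v : (n * Pn 1)%sg) : adj u v = false.
  by case: u v => i [[] //= ?] [j [[] //= ?]]; rewrite andbF.
split=> [[f f_bij adj_f]|[cG noG]].
  split=> [|x y]; last by rewrite -adj_f no_edge.
  by rewrite (bij_eq_card f_bij) card_prod !card_ord muln1.
have [|f f_bij] := @eq_card_bij G (n * Pn 1)%sg.
  by rewrite card_prod !card_ord muln1.
by exists f => // x y; rewrite no_edge (negPf (noG x y)).
Qed.

Lemma iso_Kn G n : iso G (Kn n) <-> #|G| = n /\ forall x y : co G, ~~ adj x y.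
Proof.
have adj_Kn (u v : Kn n) : adj u v = (u != v) by rewrite /= andbT.
have noE : (forall x y : co G, ~~ adj x y) <-> forall x y : G, adj x y = (x != y).
  split=> noG x y; last by rewrite /= noG andbN.
  have := noG x y; rewrite /=; case: eqP => [->|_] /=; first by rewrite adj_irr.
  by rewrite negbK.
rewrite noE; split=> [[f f_bij adj_f]|[cG adjG]].
  split=> [|x y]; last by rewrite -adj_f adj_Kn (bij_eq f_bij).
  by rewrite (bij_eq_card f_bij) card_ord.
have [|f f_bij] := @eq_card_bij G (Kn n); first by rewrite card_ord.
by exists f => // x y; rewrite adj_Kn adjG (bij_eq f_bij).
Qed.

Lemma casesAP F G c d : has_code F c -> has_code G d -> casesA F G <-> Ab c d.
Proof.
move=> Fc Gd.
have -> : casesA F G <-> ((isub F (Pn 4) \/ isub G (Pn 4)) \/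
    (exists s t, 1 <= s /\ 1 <= t /\ iso F (Kn s) /\ iso G (t * Pn 1)%sg)) \/
    sub_pair tableA F G.
  rewrite /casesA /sub_some /sub_pair /= !List.Exists_cons !List.Exists_nil /=.
  rewrite -/paw -/diamond -/gem; tauto.
apply: iff_orb; last exact: subbP.
apply: iff_orb.
  by apply: iff_orb; apply: rwP; apply: isubP => //; apply: (has_code_den (EP 4)).
split=> [[s [t [s0 [t0 []]]]]|/and4P[c0 d0 eF eG]].
  rewrite iso_Kn iso_copies_P1 => -[cF eF] [cG eG].
  rewrite -(has_code_card Fc) cF -(has_code_card Gd) cG s0 t0 /=.
  apply/andP; split; first exact/(edgelessP (has_code_co Fc)).
  exact/(edgelessP Gd).
exists (size c), (size d); rewrite iso_Kn iso_copies_P1; split=> //; split=> //.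
split; split.
- exact: has_code_card.
- exact/(edgelessP (has_code_co Fc)).
- exact: has_code_card.
exact/(edgelessP Gd).
Qed.

Lemma condBP F G c d : has_code F c -> has_code G d -> condB F G <-> Bb c d.
Proof.
move=> Fc Gd; rewrite /condB !subclassE /Bb has_codes /= orbF.
by apply: iff_orb; apply: iff_andb; apply: iff_orb; apply: rwP; apply: isubP => //;
  apply: (has_code_den (EP 6)) || apply: (has_code_den (EO (2 * EP 2)))
  || apply: (has_code_den (2 * EP 2)) || apply: (has_code_den (EO (EP 2 + EP 3))).
Qed.

Lemma casesCE F G : casesC F G <->
  (~ in_S F /\ ~ in_S G) \/ (~ in_coS F /\ ~ in_coS G) \/ sup_pair tableC F G.
Proof.
rewrite /casesC /sup_some /sup_pair /= !List.Exists_cons !List.Exists_nil /=.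
rewrite -/diamond -/gem; tauto.
Qed.

(** Shrinking the two graphs in (D) shrinks their class and so preserves the inclusion; the
    existential may therefore be restricted to the pairs in the table. *)
Lemma condDP F G c d : has_code F c -> has_code G d -> condD F G <-> Db c d.
Proof.
move=> Fc Gd.
have -> : condD F G <-> List.Exists (fun xy =>
    (isub (den xy.1) F \/ isub (den xy.2) F) /\
    (isub (den xy.1) G \/ isub (den xy.2) G)) tableD.
  have casesDE X Y : casesD X Y <-> sup_pair tableD X Y.
    rewrite /casesD /sup_some /sup_pair /= !List.Exists_cons !List.Exists_nil /=.
    rewrite -/diamond -/gem; tauto.
  split=> [[X [Y [/subclassE[XYF XYG] /casesDE]]]|].
    apply: List.Exists_impl => -[x y] /= [xX yY].
    split; [case: XYF | case: XYG];
      by [move/(isub_trans xX); left | move/(isub_trans yY); right].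
  move=> /List.Exists_exists[[x y] [xy_in [xyF xyG]]].
  exists (den x), (den y); rewrite subclassE casesDE; split=> //.
  by apply/List.Exists_exists; exists (x, y); split=> //; split; apply: isub_refl.
rewrite /Db has_codes; apply: Exists_hasP => -[x y].
apply: iff_andb; apply: iff_orb; apply: rwP; apply: isubP => //; exact: has_code_den.
Qed.

Lemma condEE F G : condE F G <->
  List.Exists (fun xy => same_pair F G (den xy.1) (den xy.2)) tableE.
Proof. by rewrite /condE /= !List.Exists_cons !List.Exists_nil. Qed.

Lemma condEP F G c d : has_code F c -> has_code G d -> condE F G <-> Eb c d.
Proof.
move=> Fc Gd; rewrite condEE /Eb has_codes.
by apply: Exists_hasP => -[x y]; apply: samebP => //; apply: has_code_den.
Qed.

Lemma emb_trans G c d : contains G d -> emb c d -> contains G c.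
Proof. by case=> t Ut <-; apply: emb_contains. Qed.

Lemma isub_den e G : isub (den e) G <-> contains G (ecode e).
Proof. by apply: isub_contains; apply: has_code_den. Qed.

Lemma contains_isub F G c : isub F G -> contains F c -> contains G c.
Proof.
move=> /isubE[g g_inj adj_g] [t Ut <-].
by have [Ug <-] := map_embedding g_inj adj_g Ut; exists (map g t).
Qed.

Lemma contains_co G c : contains G c -> contains (co G) (coc c).
Proof. by case=> t Ut <-; exists t; rewrite ?code_of_co. Qed.

Lemma contains_has_code G c : has_code G c -> contains G c.
Proof. by case=> s [Us _ Cs]; exists s. Qed.

Lemma has_Exists T (P : T -> Prop) (a : pred T) s :
  (forall x, a x -> P x) -> has a s -> List.Exists P s.
Proof.
move=> aP; elim: s => //= x s IH /orP[/aP|/IH].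
  exact: List.Exists_cons_hd.
exact: List.Exists_cons_tl.
Qed.

Lemma supb_contains tab F G c d :
  contains F c -> contains G d -> supb (codes tab) c d -> sup_pair tab F G.
Proof.
move=> Fc Gd; rewrite /supb has_codes; apply: has_Exists => -[x y] /andP[xc yd].
by split; apply/isub_den; [apply: emb_trans xc | apply: emb_trans yd].
Qed.

Lemma sup_pair_isub tab F F' G G' :
  isub F F' -> isub G G' -> sup_pair tab F G -> sup_pair tab F' G'.
Proof.
move=> FF' GG'; apply: List.Exists_impl => xy [xF yG].
by split; [apply: isub_trans FF' | apply: isub_trans GG'].
Qed.

(** * The enumeration applied to graphs in S *)

Lemma hereditary_emb G c : hereditary G (emb c).
Proof.
move=> s t Us Ut st /(embP c (@adj_sym G) (@adj_irr G) Us)[u [Uu us Cu]].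
apply/(embP c (@adj_sym G) (@adj_irr G) Ut); exists u; split=> // x /us.
exact: st.
Qed.

Lemma hereditary_supb tab G d : hereditary G (supb tab d).
Proof.
move=> s t Us Ut st; rewrite /supb !lazy_hasE => /hasP[xy xyt /andP[xd ys]].
by apply/hasP; exists xy => //; rewrite xd; apply: hereditary_emb ys.
Qed.

Lemma hereditary_supb_co tab G d : hereditary G (fun c => supb tab (coc c) d).
Proof.
move=> s t Us Ut st; rewrite /supb !lazy_hasE => /hasP[xy xyt /andP[xs yd]].
apply/hasP; exists xy => //; rewrite yd -code_of_co //; apply/andP; split=> //.
by move: xs; rewrite -code_of_co //; apply: (@hereditary_emb (co G)).
Qed.

Lemma hereditary_Cb G d : hereditary G (Cb^~ d).
Proof.
move=> s t Us Ut st /orP[|] h; apply/orP; [left | right].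
  exact: hereditary_supb_co h.
exact: hereditary_supb h.
Qed.

Lemma hereditary_excluded G : hereditary G excluded.
Proof.
move=> s t Us Ut st /orP[/orP[]|/andP[]].
- by move=> h; apply/orP; left; apply/orP; left; apply: hereditary_emb h.
- by move=> h; apply/orP; left; apply/orP; right; apply: hereditary_emb h.
by move=> h h'; apply/orP; right; apply/andP; split;
  [apply: hereditary_Cb h | apply: hereditary_Cb h'].
Qed.

(** Forests with neither [3P_1] nor [2P_2] have at most four vertices: level 5 of the enumeration is
    empty, and with it all later ones. *)
Lemma small_forests_ok :
  all (fun c => emb c code_P4)
    (forests (fun c => emb code_3P1 c ||| emb code_2P2 c) 5) &&
  (iter 5 (grow (fun c => emb code_3P1 c ||| emb code_2P2 c)) [:: [::]] == [::]).
Proof. by vm_compute. Qed.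

Lemma iter_grow_nil p n : iter n (grow p) [::] = [::].
Proof. by elim: n => //= n ->. Qed.

Lemma forest_trichotomy G : acyclic G ->
  isub G (Pn 4) \/ isub (3 * Pn 1)%sg G \/ isub (2 * Pn 2)%sg G.
Proof.
move=> acG; pose p c := emb code_3P1 c ||| emb code_2P2 c.
have hered : hereditary G p.
  move=> s t Us Ut st /orP[|] h; apply/orP; [left | right];
  exact: hereditary_emb h.
have [/orP|[t tG lev]] := acyclic_codes acG hered (enum_uniq G).
  by move=> [/emb_contains|/emb_contains] GX; right; [left|right];
    apply/(isub_den (3 * EP 1)) || apply/(isub_den (2 * EP 2));
    apply: GX; apply: enum_uniq.
left; have /andP[/allP ok /eqP lev5] := small_forests_ok.
have {ok lev lev5} tP4 : emb (code_of (@adj G) t) code_P4.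
  apply/ok/(forests_mem lev); rewrite ltnNge; apply/negP=> le5; move: lev.
  by rewrite -(subnK le5) iterD lev5 iter_grow_nil.
have Gt : has_code G (code_of (@adj G) t).
  exists t; rewrite (perm_uniq tG) enum_uniq; split=> // x.
  by rewrite (perm_mem tG) mem_enum.
exact/(isubP Gt (has_code_den (EP 4))).
Qed.

Lemma forests8_ok :
  all edgeless (iter 8 (grow excluded) [:: [::]]).
Proof. by vm_compute. Qed.

(** The enumeration is run on the first eight vertices, in an order that starts with an edge if
    there is one. Fewer than eight vertices make up the whole graph; if there are eight, only the
    edgeless code survives, and by the choice of the order the whole graph then has no edge. *)
Lemma in_S_listed G : in_S G ->
  rich (code_of (@adj G) (enum G)) \/
  exists2 c, c \in forests excluded 9 & contains G c /\
    (has_code G c /\ size c < 8 \/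
     [/\ size c = 8, edgeless c & forall x y : G, ~~ adj x y]).
Proof.
move=> GS.
have [s [Us all_s] edge_s] : exists2 s : seq G, uniq s /\ (forall x, x \in s) &
    {in take 8 s &, forall x y, ~~ adj x y} -> forall x y : G, ~~ adj x y.
  have [/existsP[x /existsP[y xy]]|no_edge] := boolP [exists x : G, exists y, adj x y].
    have xNy : x != y by apply: contraTneq xy => ->; rewrite adj_irr.
    exists [:: x, y & [seq z <- enum G | (z != x) && (z != y)]].
      split=> [|z].
        by rewrite /= !inE !mem_filter !eqxx negb_or xNy andbF filter_uniq ?enum_uniq.
      by rewrite !inE mem_filter mem_enum andbT -negb_or orbA orbN.
    by move=> /(_ x y); rewrite /= !inE !eqxx ?orbT xy => /(_ isT isT).
  exists (enum G); first by split=> [|x]; rewrite ?enum_uniq ?mem_enum.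
  move=> _ x y; apply: contra no_edge => xy.
  by apply/existsP; exists x; apply/existsP; exists y.
set u := take 8 s in edge_s.
have Uu : uniq u by apply: take_uniq.
have [exc|[t tu lev]] := acyclic_codes (in_S_acyclic GS) (@hereditary_excluded G) Uu.
  left; have := hereditary_excluded Uu (enum_uniq G) _ exc.
  move=> /(_ (fun x _ => mem_enum G x))/orP[/orP[]|//] /emb_contains h.
    by case: (in_S_no_K14 GS); apply: h; apply: enum_uniq.
  by case: (in_S_no_double_claw GS); apply: h; apply: enum_uniq.
have Ut : uniq t by rewrite (perm_uniq tu).
have le8 : size u <= 8 by rewrite /u size_take; case: (ltnP 8 (size s)).
right; exists (code_of (@adj G) t); first exact: forests_mem lev _.
split; first by exists t.
move: le8; rewrite leq_eqVlt size_code_of (perm_size tu) => /predU1P[u8|u_lt8].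
  right; rewrite u8 in lev.
  have {lev} et := allP forests8_ok _ lev; split=> //.
  by apply: edge_s => x y xu yu; apply: (edgeless_code_of t).1 et _ _ _ _;
    rewrite (perm_mem tu).
clear lev; left; split=> //; exists t; split=> // x; rewrite (perm_mem tu) /u take_oversize //.
by move: u_lt8; rewrite /u size_take; case: (ltnP 8 (size s)) => //; rewrite ltnn.
Qed.

(** * Pairs of a graph in the complement class of S and a graph in S *)

Lemma condC_complement F G H :
  iso F (co H) -> sup_pair tableC (co H) G \/ sup_pair tableC (co G) H ->
  condC F G.
Proof.
move=> FH [hC|hC].
  exists F, G; split; first by apply: equiv_same; left; split; apply: iso_refl.
  rewrite casesCE; do 2 right.
  by apply: sup_pair_isub hC; [apply/iso_isub/iso_sym | apply: isub_refl].
exists (co G), (co F); split.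
  apply: (@equiv_co _ _ F G).
    by apply: equiv_same; left; split; apply: iso_refl.
  by right; split; apply: iso_refl.
rewrite casesCE; do 2 right; apply: sup_pair_isub hC; first exact: isub_refl.
apply: iso_isub; apply: iso_trans (iso_sym (co_coK H)) _.
exact/iso_co/iso_sym.
Qed.

Lemma condA_complement F G : casesA F G \/ casesA (co G) (co F) -> condA F G.
Proof.
move=> [hA|hA]; [exists F, G | exists (co G), (co F)]; split=> //.
  by apply: equiv_same; left; split; apply: iso_refl.
apply: (@equiv_co _ _ F G); last by right; split; apply: iso_refl.
by apply: equiv_same; left; split; apply: iso_refl.
Qed.

Lemma Cb_contains F G c d : contains F c -> contains G d -> Cb c d ->
  sup_pair tableC (co F) G \/ sup_pair tableC (co G) F.
Proof.
move=> Fc Gd /orP[] h; [left | right].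
  exact: (supb_contains (contains_co Fc) Gd h).
exact: (supb_contains (contains_co Gd) Fc h).
Qed.

Lemma eqv_iso G c e : has_code G c -> eqv c (ecode e) -> iso G (den e).
Proof. by move=> Gc h; apply/(isoP Gc (has_code_den e)). Qed.

Lemma rich_sup_pair F G : rich (code_of (@adj F) (enum F)) ->
  isub (3 * Pn 1)%sg G \/ isub (2 * Pn 2)%sg G ->
  sup_pair tableC (co F) G \/ sup_pair tableC (co G) F.
Proof.
move=> /andP[h3P1 h2P2].
have Fc := contains_has_code (has_code_enum F).
have step e : Cb (code_of (@adj F) (enum F)) (ecode e) -> isub (den e) G ->
    sup_pair tableC (co F) G \/ sup_pair tableC (co G) F.
  move=> h eG; case: (Cb_contains Fc (contains_has_code (has_code_den e)) h) => h'.
    by left; apply: sup_pair_isub h'; [apply: isub_refl | ].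
  by right; apply: sup_pair_isub h'; [apply: isub_co | apply: isub_refl].
by case; [apply: (step (3 * EP 1)%gx h3P1) | apply: (step (2 * EP 2)%gx h2P2)].
Qed.

Lemma Db_contains F G c d : contains F c -> contains G d -> Db c d -> condD F G.
Proof.
move=> Fc Gd h; apply/(condDP (has_code_enum F) (has_code_enum G)).
move: h; rewrite /Db !lazy_hasE => /hasP[[x y] xy /andP[/orP hF /orP hG]].
have mono K k z : contains K k -> emb z k -> emb z (code_of (@adj K) (enum K)).
  by move=> Kk /(emb_trans Kk); move/(has_code_containsP _ (has_code_enum K)).
apply/hasP; exists (x, y) => //; apply/andP; split; apply/orP.
  by case: hF => /(mono _ _ _ Fc) h; [left | right].
by case: hG => /(mono _ _ _ Gd) h; [left | right].
Qed.

(** Here [F] is the complement of [H]. Either one of [H] and [G] is rich or contained in [P_4], or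
    both are listed; then the verdict of [small_pairs_ok] carries over, and the hypotheses discard
    the pairs that are left out of the theorem. *)
Lemma S_coS_pair F G : in_coS F -> in_S G ->
  ~ iso F (co (Pn 1 + Pn 3)%sg) -> ~ iso G (Pn 1 + Pn 3)%sg ->
  ~ same_pair F G (3 * Pn 1)%sg (co (Sclaw 1 2 3)) ->
  condA F G \/ condB F G \/ condC F G \/ condD F G \/ condE F G.
Proof.
case=> H HS FH GS F_paw G_copaw exc.
have coF_H : iso (co F) H := iso_trans (iso_co FH) (co_coK H).
have P4A : isub H (Pn 4) \/ isub G (Pn 4) -> condA F G.
  case=> sP4; apply: condA_complement; [right | left]; left; right=> //.
  exact: isub_trans (iso_isub coF_H) sP4.
have [?|HT] := forest_trichotomy (in_S_acyclic HS); first by left; apply: P4A; left.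
have [?|GT] := forest_trichotomy (in_S_acyclic GS); first by left; apply: P4A; right.
have [hr|[c c_in [Hc c_code]]] := in_S_listed HS.
  by do 2 right; left; apply: condC_complement FH (rich_sup_pair hr GT).
have [hr|[d d_in [Gd d_code]]] := in_S_listed GS.
  do 2 right; left; apply: condC_complement FH _.
  by case: (rich_sup_pair hr HT); [right | left].
have FHc : contains F (coc c).
  exact: contains_isub (iso_isub (iso_sym FH)) (contains_co Hc).
(* Below eight vertices the listed code describes the whole graph. *)
have small_code K k : has_code K k /\ size k < 8 \/
    [/\ size k = 8, edgeless k & forall x y : K, ~~ adj x y] ->
    size k < 8 -> has_code K k.
  by case=> [[]|[->]].
have small_size k e : size (ecode e) < 8 -> emb k (ecode e) -> size k < 8.
  by rewrite /emb; case: ifP => // le lt _; apply: leq_ltn_trans le lt.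
have F_c : size c < 8 -> has_code F (coc c).
  by move=> /(small_code H c c_code)/has_code_co; apply: iso_has_code (iso_sym FH).
have G_d : size d < 8 -> has_code G d := small_code G d d_code.
have H_c : size c < 8 -> has_code H c := small_code H c c_code.
have := allP (allP small_pairs_ok c c_in) d d_in.
case/orP=> [/orP[/orP[/orP[/orP[/orP[cP4|dP4]|hC]|hD]|/orP[cP|dP]]|/andP[ec ed]]|].
- left; apply: P4A; left; apply/(isubP _ (has_code_den (EP 4)));
    last exact: cP4.
  exact: H_c (small_size _ (EP 4) isT cP4).
- left; apply: P4A; right; apply/(isubP _ (has_code_den (EP 4)));
    last exact: dP4.
  exact: G_d (small_size _ (EP 4) isT dP4).
- by do 2 right; left; apply: condC_complement FH (Cb_contains Hc Gd hC).
- by do 3 right; left; apply: Db_contains FHc Gd hD.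
- case: F_paw; apply: iso_trans FH _; apply: iso_co.
  apply: (eqv_iso (e := (EP 1 + EP 3)%gx) _ cP); apply: H_c.
  by case/andP: cP => /eqP -> _.
- case: G_copaw; apply: (eqv_iso (e := (EP 1 + EP 3)%gx) _ dP); apply: G_d.
  by case/andP: dP => /eqP -> _.
(* Neither [H] nor [G] has an edge, so (A) holds with a complete and an edgeless graph. Both are
   non-empty, since each contains [3P_1] or [2P_2]. *)
- have no_edge K k : has_code K k /\ size k < 8 \/
      [/\ size k = 8, edgeless k & forall x y : K, ~~ adj x y] ->
      edgeless k -> edgeless (code_of (@adj K) (enum K)).
    move=> k_code ek; apply/(edgelessP (has_code_enum K)).
    by case: k_code => [[/edgelessP Kk _]|[]//]; apply/Kk.
  have eH := no_edge _ _ c_code ec; have eG := no_edge _ _ d_code ed.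
  left; apply: condA_complement; left.
  have Hcode := iso_has_code (iso_sym FH) (has_code_co (has_code_enum H)).
  apply/(casesAP Hcode (has_code_enum G)); rewrite /Ab cocK eH eG.
  rewrite /coc size_map !size_code_of -!cardE.
  have pos K : isub (3 * Pn 1)%sg K \/ isub (2 * Pn 2)%sg K -> 0 < #|K|.
    by case=> /isubE[g _ _]; apply/card_gt0P; exists (g (ord0, ord0)).
  by rewrite !pos //; apply/orP; left; apply/orP; right.
case/andP=> /andP[/F_c Fcode /G_d Gcode].
have coF_c : has_code (co F) c by rewrite -[c]cocK; apply: has_code_co.
case/orP=> [/orP[/orP[/orP[hA|hA]|hB]|hE]|hexc].
- by left; apply: condA_complement; left; apply/(casesAP Fcode Gcode).
- left; apply: condA_complement; right.
  exact/(casesAP (has_code_co Gcode) coF_c).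
- by right; left; apply/(condBP Fcode Gcode).
- by do 4 right; apply/(condEP Fcode Gcode).
case: exc; apply/(samebP Fcode Gcode (has_code_den (3 * EP 1)))/hexc.
exact: (has_code_den (EO (ES 1 2 3))).
Qed.

Lemma equiv_pair_swap H1 H2 F1 F2 :
  equiv_pair H1 H2 F1 F2 -> equiv_pair H2 H1 F1 F2.
Proof.
elim=> [X Y|X Y Z W _ IH|X Y Z W V _ IH|X Y Z W V _ IH] same.
- by apply: equiv_same; case: same => -[]; [right | left].
- exact: equiv_co IH same.
- exact: equiv_3P1_P1P3 IH same.
exact: equiv_P1P3_3P1 IH same.
Qed.

Lemma free_swap F G : subclass (free F G) (free G F).
Proof. by move=> H []. Qed.

Lemma cond_swap F G :
  condA F G \/ condB F G \/ condC F G \/ condD F G \/ condE F G ->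
  condA G F \/ condB G F \/ condC G F \/ condD G F \/ condE G F.
Proof.
case=> [[X [Y [XY hA]]]|[hB|[[X [Y [XY hC]]]|[[X [Y [XY hD]]]|hE]]]].
- by left; exists X, Y; split=> //; apply: equiv_pair_swap.
- by right; left; case: hB => hB; [left | right] => H /free_swap/hB.
- by do 2 right; left; exists X, Y; split=> //; apply: equiv_pair_swap.
- by do 3 right; left; exists X, Y; split=> // H /XY/free_swap.
by do 4 right; apply: List.Exists_impl hE => p [[]|[]]; [right | left].
Qed.

(** The last premise ranges over all lists with code [c]: for a concrete [c], a case analysis on the
    list lets the degrees be computed. *)
Lemma acyclic_min_degree2 G c : acyclic G -> contains G c -> 0 < size c ->
  (forall s : seq G, code_of (@adj G) s = c ->
    all (fun x => 1 < count (adj x) s) s) -> False.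
Proof.
move=> acG [s Us <-]; rewrite size_code_of => s0 /(_ s erefl)/allP dense.
have [|x xs] := acG s Us; first by rewrite -size_eq0 -lt0n.
by rewrite leqNgt dense.
Qed.

(** Otherwise [F] contains [3P_1] or [2P_2], and its complement, a forest, contains [K_3] or
    [C_4]. *)
Lemma S_coS_sub_P4 F : in_S F -> in_coS F -> isub F (Pn 4).
Proof.
move=> /in_S_acyclic acF [H /in_S_acyclic acH FH].
have coH e : isub (den e) F -> contains H (coc (ecode e)).
  move=> eF; apply: contains_isub (iso_isub (co_coK H)) (contains_co _).
  exact: contains_isub (iso_isub FH) ((isub_den e F).1 eF).
have [//|[/(coH (3 * EP 1)%gx)|/(coH (2 * EP 2)%gx)] hc] := forest_trichotomy acF.
  apply: False_ind; apply: (acyclic_min_degree2 acH hc) => // s.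
  rewrite (_ : coc _ = [:: [:: true; true]; [:: true]; [::]]) //.
  case: s => [|x [|y [|z [|? ?]]]] // [xy xz yz].
  have [yx zx] := (adj_sym y x, adj_sym z x); have zy := adj_sym z y.
  by rewrite /= !adj_irr yx zx zy xy xz yz.
apply: False_ind; apply: (acyclic_min_degree2 acH hc) => // s.
rewrite (_ : coc _ = [:: [:: false; true; true]; [:: true; true];
  [:: false]; [::]]) //.
case: s => [|x [|y [|z [|t [|? ?]]]]] // [xy xz xt yz yt zt].
have [yx zx] := (adj_sym y x, adj_sym z x); have tx := adj_sym t x.
have [zy ty] := (adj_sym z y, adj_sym t y); have tz := adj_sym t z.
by rewrite /= !adj_irr yx zx tx zy ty tz xy xz xt yz yt zt.
Qed.

(** * The open cases *)

(* A pair [(a, b)] of graphs in S stands for the pair of graphs {co a, b}.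
   Complementing the latter amounts to exchanging [a] and [b]. *)
Definition half_orbits : seq (gexp * gexp) :=
  [:: (2 * EP 1 + EP 2, EP 6);
      (2 * EP 2, EP 1 + 2 * EP 2); (2 * EP 2, EP 2 + EP 4); (2 * EP 2, 3 * EP 2);
      (EP 1 + 2 * EP 2, EP 2 + EP 3); (EP 1 + 2 * EP 2, EP 5);
      (EP 2 + EP 3, EP 2 + EP 3); (EP 2 + EP 3, EP 5);
      (3 * EP 1, EP 1 + ES 1 1 3); (3 * EP 1, ES 1 2 3);
      (EP 1 + EP 3, EP 1 + ES 1 1 3); (EP 1 + EP 3, ES 1 2 3);
      (2 * EP 1 + EP 2, EP 1 + EP 2 + EP 3); (2 * EP 1 + EP 2, EP 1 + EP 5);
      (EP 1 + EP 4, EP 2 + EP 3)]%gx.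

(** Adding the exchanged pairs closes the list under complementation; the entries with [P_1+P_3]
    close it under the interchange with [3P_1]. *)
Definition orbits : seq (gexp * gexp) :=
  half_orbits ++ [seq (ab.2, ab.1) | ab <- half_orbits].

Definition pair_of (a b : gexp) (F G : sgraph) : Prop :=
  iso F (co (den a)) /\ iso G (den b) \/ iso F (den b) /\ iso G (co (den a)).

Definition in_orbits (F G : sgraph) : Prop :=
  List.Exists (fun ab => pair_of ab.1 ab.2 F G) orbits.

Definition pair_code (a b : gexp) (c d : code) : bool :=
  sameb c d (coc (ecode a)) (ecode b).

Lemma tableE_orbits :
  all (fun xy => has (fun ab =>
    pair_code ab.1 ab.2 (ecode xy.1) (ecode xy.2)) orbits) tableE.
Proof. by vm_compute. Qed.

Lemma orbits_leggy : all (fun ab => leggy_exp ab.1 && leggy_exp ab.2) orbits.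
Proof. by vm_compute. Qed.

Lemma nor4 (a b c d : bool) :
  ~~ (a || b || c || d) -> [/\ ~~ a, ~~ b, ~~ c & ~~ d].
Proof. by case: a b c d => -[] [] []. Qed.

Definition not_AC (c d : code) : bool :=
  ~~ (Ab c d || Ab d c || supb codesC c d || supb codesC d c).

Lemma orbits_not_AC :
  all (fun ab => not_AC (coc (ecode ab.1)) (ecode ab.2)) orbits.
Proof. by vm_compute. Qed.

Definition not_BD (c d : code) : bool :=
  ~~ (Bb c d || Bb d c || Db c d || Db d c).

(** (B) and (D) speak of the pair itself and not of its equivalence class, so they are refuted on
    the listed pairs, in both orders. *)
Lemma tableE_not_BD :
  all (fun xy => not_BD (ecode xy.1) (ecode xy.2)) tableE.
Proof. by vm_compute. Qed.

(** The complemented graph of an entry is never [3P_1] or [P_1+P_3], so a replacement affects the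
    other graph, and it leads to an entry again. *)
Lemma orbits_closed e f :
  (e, f) = (3 * EP 1, EP 1 + EP 3)%gx \/ (e, f) = (EP 1 + EP 3, 3 * EP 1)%gx ->
  all (fun ab => ~~ eqv (coc (ecode ab.1)) (ecode e) &&
    (~~ eqv (ecode ab.2) (ecode e) |||
     has (fun ab' => eqv (ecode ab'.1) (ecode ab.1) &&
                     eqv (ecode ab'.2) (ecode f)) orbits)) orbits.
Proof. by case=> -[-> ->]; vm_compute. Qed.

Lemma all_In T (p : pred T) s x : all p s -> List.In x s -> p x.
Proof. by elim: s => //= y s IH /andP[py /IH{}IH] [<-|]. Qed.

Lemma pair_of_swap a b F G : pair_of a b F G -> pair_of a b G F.
Proof. by case=> -[]; [right | left]. Qed.

Lemma pair_codeP a b F G c d : has_code F c -> has_code G d ->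
  pair_of a b F G <-> pair_code a b c d.
Proof.
move=> Fc Gd; apply: (samebP Fc Gd); last exact: has_code_den.
exact/has_code_co/has_code_den.
Qed.

Lemma in_orbits_same F G X Y :
  in_orbits F G -> same_pair X Y F G -> in_orbits X Y.
Proof.
move=> FG XY; apply: List.Exists_impl FG => -[a b] /= abFG.
have {XY abFG} : exists F' G', [/\ iso X F', iso Y G' & pair_of a b F' G'].
  case: XY => -[XF YG]; first by exists F, G.
  by exists G, F; split=> //; apply: pair_of_swap.
move=> [F' [G' [XF YG [[Fa Gb]|[Fb Ga]]]]]; [left | right];
  by split; [apply: iso_trans XF _ | apply: iso_trans YG _].
Qed.

Lemma In_cat T (s t : seq T) x :
  List.In x (s ++ t) <-> List.In x s \/ List.In x t.
Proof. exact: List.in_app_iff. Qed.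

Lemma in_orbits_co F G : in_orbits F G -> in_orbits (co F) (co G).
Proof.
move=> /List.Exists_exists[[a b] [ab_in abFG]].
apply/List.Exists_exists; exists (b, a); split.
  have swap s : List.In (a, b) s -> List.In (b, a) [seq (xy.2, xy.1) | xy <- s].
    by elim: s => //= xy s IH [->|/IH]; [left | right].
  have swapK s : List.In (a, b) [seq (xy.2, xy.1) | xy <- s] -> List.In (b, a) s.
    by elim: s => //= -[x y] s IH [[-> ->]|/IH]; [left | right].
  apply/In_cat; move/In_cat: ab_in.
  by case=> [/swap|/swapK]; [right | left].
case: abFG => -[Fx Gy]; [right | left]; split.
- by apply: iso_trans (iso_co Fx) (co_coK _).
- exact: iso_co.
- exact: iso_co.
by apply: iso_trans (iso_co Gy) (co_coK _).
Qed.

Lemma in_orbits_replace e f G :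
  (e, f) = (3 * EP 1, EP 1 + EP 3)%gx \/ (e, f) = (EP 1 + EP 3, 3 * EP 1)%gx ->
  in_orbits (den e) G -> in_orbits (den f) G.
Proof.
move=> /orbits_closed closed /List.Exists_exists[[a b] [ab_in abFG]].
have /andP[not_e replace] := all_In closed ab_in.
have code_e := has_code_den e.
case: abFG => -[ea Gb].
  case/negP: not_e.
  exact/(isoP (has_code_co (has_code_den a)) code_e)/iso_sym.
rewrite (introT (isoP (has_code_den b) code_e) (iso_sym ea)) in replace.
apply: has_Exists replace => -[a' b'] /= /andP[a'a b'f].
right; split; first by apply: iso_sym; apply/(isoP (has_code_den b') (has_code_den f)).
apply: iso_trans Gb (iso_co (iso_sym _)).
exact/(isoP (has_code_den a') (has_code_den a)).
Qed.

Lemma same_pair_sym F G X Y : same_pair F G X Y -> same_pair X Y F G.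
Proof. by case=> -[/iso_sym FX /iso_sym GY]; [left | right]. Qed.

Lemma in_orbits_equiv F G X Y :
  in_orbits F G -> equiv_pair F G X Y -> in_orbits X Y.
Proof.
move=> FG; elim=> [X1 Y1|X1 Y1 X2 Y2 _ IH|X1 Y1 X2 Y2 Z _ IH XYZ|X1 Y1 X2 Y2 Z _ IH XYZ].
- exact: in_orbits_same.
- exact/in_orbits_same/in_orbits_co.
- apply/in_orbits_same/(in_orbits_replace (e := 3 * EP 1) (f := EP 1 + EP 3)%gx).
    by left.
  exact: in_orbits_same IH (same_pair_sym XYZ).
apply/in_orbits_same/(in_orbits_replace (e := EP 1 + EP 3) (f := 3 * EP 1)%gx).
  by right.
exact: in_orbits_same IH (same_pair_sym XYZ).
Qed.

(** One graph of the pair is in the complement class of S and the other in S, which refutes the two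
    cases of (C) on membership; the remaining cases are refuted by computation, in both orders. *)
Lemma in_orbits_not_AC F G : in_orbits F G -> ~ casesA F G /\ ~ casesC F G.
Proof.
move=> /List.Exists_exists[[a b] [ab_in abFG]].
have /andP[/= leg_a leg_b] := all_In orbits_leggy ab_in.
have := all_In orbits_not_AC ab_in.
case/nor4=> nA nA' nC nC'.
have code_a := has_code_co (has_code_den a); have code_b := has_code_den b.
have S_b K : iso K (den b) -> in_S K by apply: leggy_exp_in_S.
have coS_a K : iso K (co (den a)) -> in_coS K.
  by exists (den a) => //; apply: leggy_exp_in_S leg_a (iso_refl _).
rewrite casesCE; case: abFG => /= -[FX GY].
  have Fc := iso_has_code (iso_sym FX) code_a.
  have Gd := iso_has_code (iso_sym GY) code_b.
  split=> [/(casesAP Fc Gd) h|]; first exact: negP nA h.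
  case=> [[_ nS]|[[nS _]|]]; [exact: nS (S_b _ GY) | exact: nS (coS_a _ FX) | ].
  move/(supbP Fc Gd)=> h; exact: negP nC h.
have Fc := iso_has_code (iso_sym FX) code_b.
have Gd := iso_has_code (iso_sym GY) code_a.
split=> [/(casesAP Fc Gd) h|]; first exact: negP nA' h.
case=> [[nS _]|[[_ nS]|]]; [exact: nS (S_b _ FX) | exact: nS (coS_a _ GY) | ].
move/(supbP Fc Gd)=> h; exact: negP nC' h.
Qed.

Lemma condE_in_orbits F G :
  condE F G -> [/\ in_orbits F G, ~ condB F G & ~ condD F G].
Proof.
move=> /condEE/List.Exists_exists[[x y] [xy_in FGxy]].
have := all_In tableE_orbits xy_in.
have := all_In tableE_not_BD xy_in.
case/nor4=> nB nB' nD nD' xy_orb.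
have x_code := has_code_den x; have y_code := has_code_den y.
split.
- apply: in_orbits_same FGxy.
  by apply: has_Exists xy_orb => ab /(pair_codeP _ _ x_code y_code).
- case: FGxy => -[/iso_sym Fx /iso_sym Gy].
    move/(condBP (iso_has_code Fx x_code) (iso_has_code Gy y_code)) => h;
      exact: negP nB h.
  move/(condBP (iso_has_code Fx y_code) (iso_has_code Gy x_code)) => h;
    exact: negP nB' h.
case: FGxy => -[/iso_sym Fx /iso_sym Gy].
  move/(condDP (iso_has_code Fx x_code) (iso_has_code Gy y_code)) => h;
    exact: negP nD h.
move/(condDP (iso_has_code Fx y_code) (iso_has_code Gy x_code)) => h;
  exact: negP nD' h.
Qed.

Theorem theorem31 (H1 H2 : sgraph)
  (H1_not_paw : ~ iso H1 (co (Pn 1 + Pn 3)%sg))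
  (H1_not_copaw : ~ iso H1 (Pn 1 + Pn 3)%sg)
  (H2_not_paw : ~ iso H2 (co (Pn 1 + Pn 3)%sg))
  (H2_not_copaw : ~ iso H2 (Pn 1 + Pn 3)%sg)
  (not_exceptional : ~ same_pair H1 H2 (3 * Pn 1)%sg (co (Sclaw 1 2 3))) :
  (~ condA H1 H2 /\ ~ condB H1 H2 /\ ~ condC H1 H2 /\ ~ condD H1 H2) <->
  condE H1 H2.
Proof.
have code1 := has_code_enum H1; have code2 := has_code_enum H2.
split=> [[nA [nB [nC nD]]]|E12].
  (* (E) is decided by [Eb], so the argument may go by contradiction without deciding membership in
     S. *)
  apply/(condEP code1 code2); apply: contraT => /negP nE.
  have not_12 : in_coS H1 -> in_S H2 -> False.
    move=> coS1 S2.
    have := S_coS_pair coS1 S2 H1_not_paw H2_not_copaw not_exceptional.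
    by case=> [//|[//|[//|[//|/(condEP code1 code2)]]]].
  have not_21 : in_coS H2 -> in_S H1 -> False.
    move=> coS2 S1.
    have := S_coS_pair coS2 S1 H2_not_paw H1_not_copaw.
    have exc : ~ same_pair H2 H1 (3 * Pn 1)%sg (co (Sclaw 1 2 3)).
      by move=> h; apply: not_exceptional; case: h => -[]; [right | left].
    move=> /(_ exc)/cond_swap.
    by case=> [//|[//|[//|[//|/(condEP code1 code2)]]]].
  have refl12 : equiv_pair H1 H2 H1 H2.
    by apply: equiv_same; left; split; apply: iso_refl.
  have not_sub_P4 : ~ (isub H1 (Pn 4) \/ isub H2 (Pn 4)).
    by move=> P4; apply: nA; exists H1, H2; split=> //; left.
  (* If one of the graphs were in S, neither would be in the complement class, which is a case of
     (C). Hence neither is in S, which is again a case of (C). *)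
  have no_S : in_S H1 \/ in_S H2 -> False.
    move=> S12; apply: nC; exists H1, H2; split=> //; rewrite casesCE.
    right; left; split=> coS; case: S12 => S.
    - by apply: not_sub_P4; left; apply: S_coS_sub_P4.
    - exact: not_12 coS S.
    - exact: not_21 coS S.
    by apply: not_sub_P4; right; apply: S_coS_sub_P4.
  case: nC; exists H1, H2; split=> //; rewrite casesCE.
  by left; split=> S; apply: no_S; [left | right].
(* Conversely, every pair equivalent to a listed one stays in [orbits], where the cases of (A) and
   (C) fail. *)
have [orb12 nB nD] := condE_in_orbits E12.
by split; [|split=> //; split=> //];
  move=> [X [Y [/(in_orbits_equiv orb12)/in_orbits_not_AC[nA nC]]]].
Qed.
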